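(* Let $(\widetilde{\mathcal T}_j)_{j\in J}$ be a family of $\mathbb T$-valued random variables (random trees). The family of their laws is tight on $(\mathbb T,\boldsymbol\delta)$ if and only if for every fixed $h,a\in(0,\infty)$ the family of laws of the $\mathbb N$-valued random variables $(Z^{(h)}_a(\widetilde{\mathcal T}_j))_{j\in J}$ is tight. The same result holds true when $(Z^{(h)}_a(\widetilde{\mathcal T}_j))_{j\in J}$ is replaced by $(Z^{(h)}_{a+}(\widetilde{\mathcal T}_j))_{j\in J}$.
   Context: A rooted real tree is a metric space $(T,d)$ with a distinguished point $\rho\in T$ (the root) such that: (1) for all $\sigma,\sigma'\in T$ there is a unique isometry $f:[0,d(\sigma,\sigma')]\to T$ with $f(0)=\sigma$, $f(d(\sigma,\sigma'))=\sigma'$, whose image is denoted $[[\sigma,\sigma']]$; (2) every continuous injective $q:[0,1]\to T$ satisfies $q([0,1])=[[q(0),q(1)]]$. A CLCR real tree is a complete locally compact rooted real tree (its closed balls are then compact). Two CLCR real trees are equivalent if there is a root-preserving isometry from one onto the other; $\widetilde T$ is the equivalence class of $T$ and $\mathbb T$ is the set of all such classes. For compact pointed metric spaces, $\boldsymbol\delta_{\rm cpct}(X_1,X_2)=\inf\{d_{\rm Haus}(f_1(X_1),f_2(X_2))\vee d(f_1(\rho_1),f_2(\rho_2))\}$, the infimum being over all isometric embeddings $f_i:X_i\to E$ into a common metric space $(E,d)$, with $d_{\rm Haus}$ the Hausdorff distance. For CLCR real trees, $\boldsymbol\delta(T_1,T_2)=\sum_{k\ge1}2^{-k}\boldsymbol\delta_{\rm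 cpct}(\overline B_{T_1}(\rho_1,k),\overline B_{T_2}(\rho_2,k))$, where $\overline B_{T}(\rho,k)$ is the closed ball of centre $\rho$ and radius $k$. $(\mathbb T,\boldsymbol\delta)$ is a Polish space, equipped with its Borel $\sigma$-field. For $h\in(0,\infty)$, the $h$-leaf-length erased tree is $R_h(T)=\{\rho\}\cup\{\sigma\in T:\exists\sigma'\in T,\ \sigma\in[[\rho,\sigma']],\ d(\sigma,\sigma')\ge h\}$. For $a\in[0,\infty)$, $h\in(0,\infty)$, $Z^{(h)}_a(T)=\#\{\sigma\in R_h(T):d(\rho,\sigma)=a\}$. For a CLCR real tree, $a\mapsto Z^{(h)}_a(T)$ is $\mathbb N$-valued, left-continuous with right limits; $Z^{(h)}_{a+}(T)$ denotes its right limit at $a$. These quantities depend only on $\widetilde T$ and define measurable functions on $\mathbb T$. *)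

(* Defs.v *)
From HB Require Import structures.
From mathcomp Require Import all_boot all_order all_algebra finmap.
From mathcomp Require Import all_classical all_reals all_analysis.

Set Implicit Arguments.
Unset Strict Implicit.
Unset Printing Implicit Defensive.

Import Order.TTheory GRing.Theory Num.Theory.
Import numFieldNormedType.Exports.

Local Open Scope classical_set_scope.
Local Open Scope ring_scope.
Local Open Scope quotient_scope.

(* The set of classes of real trees has to be a library type itself, whence a
   carrier in a universe below the one of the library's [metricType]s. Each
   [metric_space] is canonically a [metricType]. *)
Record metric_space (R : realType) := MetricSpace {
  carrier :> Type;
  dist : carrier -> carrier -> R;
  distxx : forall x, dist x x = 0;
  dist_positivity : forall x y, dist x y = 0 -> x = y;
  dist_sym : forall x y, dist x y = dist y x;
  dist_triangle : forall y x z, dist x z <= dist x y + dist y z }.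

HB.instance Definition _ (R : realType) (T : metric_space R) :=
  gen_eqMixin (carrier T).
HB.instance Definition _ (R : realType) (T : metric_space R) :=
  gen_choiceMixin (carrier T).
HB.instance Definition _ (R : realType) (T : metric_space R) :=
  isMetric.Build R (carrier T) (@distxx R T) (@dist_positivity R T)
    (@dist_sym R T) (@dist_triangle R T).

(* A map [0, d(x, y)] -> T is represented by a function on R, of which only the
   values on [0, d(x, y)] are constrained. *)
Definition is_geodesic (R : realType) (T : metricType R) (x y : T)
    (f : R -> T) : Prop :=
  [/\ f 0 = x, f (mdist x y) = y &
      {in `[0, mdist x y] &, forall s t, mdist (f s) (f t) = `|s - t|}].

Definition segment (R : realType) (T : metricType R) (x y : T) : set T :=
  [set z | exists2 f, is_geodesic x y f & (f @` `[0, mdist x y]) z].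

Definition is_real_tree (R : realType) (T : metricType R) : Prop :=
  (forall x y : T,
     (exists f, is_geodesic x y f) /\
     (forall f g, is_geodesic x y f -> is_geodesic x y g ->
        {in `[0, mdist x y], f =1 g})) /\
  (forall q : R -> T, {within `[0, 1], continuous q} ->
     {in `[0, 1] &, injective q} -> q @` `[0, 1] = segment (q 0) (q 1)).

Definition is_complete (T : uniformType) : Prop :=
  forall F : set_system T, ProperFilter F -> cauchy F -> exists x : T, F --> x.

Record clcr_tree (R : realType) := ClcrTree {
  tree_space :> metric_space R;
  tree_root : tree_space;
  clcr_real_tree : is_real_tree tree_space;
  clcr_complete : is_complete tree_space;
  clcr_locally_compact : locally_compact [set: tree_space] }.

Definition tree_equiv (R : realType) (T1 T2 : clcr_tree R) : Prop :=
  exists f : T1 -> T2,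
    [/\ forall x y, mdist (f x) (f y) = mdist x y,
        forall z, exists x, f x = z & f (tree_root T1) = tree_root T2].

Lemma tree_equiv_refl (R : realType) (T : clcr_tree R) : tree_equiv T T.
Proof. by exists id; split=> // z; exists z. Qed.

Lemma tree_equiv_sym (R : realType) (T1 T2 : clcr_tree R) :
  tree_equiv T1 T2 -> tree_equiv T2 T1.
Proof.
move=> [f [fi fs fr]]; have [g gK] := choice fs.
exists g; split=> [x y|x|].
- by rewrite -fi !gK.
- by exists (f x); apply: mdist_positivity; rewrite -fi gK mdistxx.
- by apply: mdist_positivity; rewrite -fi gK fr mdistxx.
Qed.

Lemma tree_equiv_trans (R : realType) (T1 T2 T3 : clcr_tree R) :
  tree_equiv T1 T2 -> tree_equiv T2 T3 -> tree_equiv T1 T3.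
Proof.
move=> [f [fi fs fr]] [g [gi gs gr]]; exists (g \o f); split=> [x y|z|].
- by rewrite /= gi fi.
- by have [y <-] := gs z; have [x <-] := fs y; exists x.
- by rewrite /= fr.
Qed.

HB.instance Definition _ (R : realType) := gen_eqMixin (clcr_tree R).
HB.instance Definition _ (R : realType) := gen_choiceMixin (clcr_tree R).

Definition tree_equivb (R : realType) : rel (clcr_tree R) :=
  fun T1 T2 => `[< tree_equiv T1 T2 >].

Lemma tree_equivb_refl (R : realType) : reflexive (@tree_equivb R).
Proof. by move=> T; apply/asboolP/tree_equiv_refl. Qed.

Lemma tree_equivb_sym (R : realType) : symmetric (@tree_equivb R).
Proof. by move=> T1 T2; apply/asboolP/asboolP => /tree_equiv_sym. Qed.

Lemma tree_equivb_trans (R : realType) : transitive (@tree_equivb R).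
Proof.
by move=> T2 T1 T3 /asboolP h /asboolP k; apply/asboolP/(tree_equiv_trans h k).
Qed.

Canonical tree_equiv_rel (R : realType) := EquivRel (@tree_equivb R)
  (@tree_equivb_refl R) (@tree_equivb_sym R) (@tree_equivb_trans R).

Definition trees (R : realType) : Type := {eq_quot (@tree_equivb R)}.

HB.instance Definition _ (R : realType) := Choice.on (trees R).

Definition tree_class (R : realType) (T : clcr_tree R) : trees R :=
  \pi_{eq_quot (@tree_equivb R)} T.

Definition tree_repr (R : realType) (t : trees R) : clcr_tree R :=
  repr (t : {eq_quot (@tree_equivb R)}).

Definition hausdorff_dist (R : realType) (E : metricType R) (A B : set E) : R :=
  inf [set e | [/\ 0 < e, forall x, A x -> exists2 y, B y & mdist x y <= e &
                          forall y, B y -> exists2 x, A x & mdist x y <= e]].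

(* The pointed metric spaces compared here are (A1, x1) and (A2, x2), where Ai
   is a subset of Xi containing xi; an isometric embedding of Ai is represented
   by a function on Xi which is isometric on Ai. *)
Definition delta_cpct (R : realType) (X1 X2 : metricType R)
    (A1 : set X1) (x1 : X1) (A2 : set X2) (x2 : X2) : R :=
  inf [set r | exists (E : metricType R) (f1 : X1 -> E) (f2 : X2 -> E),
    [/\ {in A1 &, forall x y, mdist (f1 x) (f1 y) = mdist x y},
        {in A2 &, forall x y, mdist (f2 x) (f2 y) = mdist x y} &
        r = Num.max (hausdorff_dist (f1 @` A1) (f2 @` A2))
                    (mdist (f1 x1) (f2 x2))]].

Definition root_ball (R : realType) (T : clcr_tree R) (r : R) : set T :=
  [set x | mdist (tree_root T) x <= r].
Arguments root_ball {R} T r.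

Definition tree_delta (R : realType) (T1 T2 : clcr_tree R) : R :=
  \big[+%R/0]_(1 <= k <oo)
    (2 ^- k * delta_cpct (root_ball T1 k%:R) (tree_root T1)
                         (root_ball T2 k%:R) (tree_root T2)).

Definition delta (R : realType) (t1 t2 : trees R) : R :=
  tree_delta (tree_repr t1) (tree_repr t2).

Definition delta_open (R : realType) : set_system (trees R) :=
  [set U | forall t, U t ->
     exists2 e : R, 0 < e & forall u, delta t u < e -> U u].

Lemma delta_openT (R : realType) : @delta_open R setT.
Proof. by move=> t _; exists 1. Qed.

Lemma delta_openI (R : realType) : setI_closed (@delta_open R).
Proof.
move=> U V oU oV t [Ut Vt]; have [e e0 eU] := oU t Ut.
have [e' e'0 eV] := oV t Vt; exists (Num.min e e').
  by rewrite lt_min e0.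
by move=> u; rewrite lt_min => /andP[/eU ? /eV].
Qed.

Lemma delta_open_bigU (R : realType) (I : Type) (f : I -> set (trees R)) :
  (forall i, delta_open (f i)) -> delta_open (\bigcup_i f i).
Proof.
move=> of_ t [i _ fit]; have [e e0 ef] := of_ i t fit.
by exists e => // u /ef fiu; exists i.
Qed.

HB.instance Definition _ (R : realType) := isOpenTopological.Build (trees R)
  (@delta_openT R) (@delta_openI R) (@delta_open_bigU R).

(* The library requires measurable types to be pointed: we use the class of the
   tree reduced to its root. *)
Lemma singleton_positivity (R : realType) (x y : unit) : 0 = 0 :> R -> x = y.
Proof. by case: x; case: y. Qed.

Lemma singleton_triangle (R : realType) : 0 <= 0 + 0 :> R.
Proof. by rewrite addr0. Qed.

Definition singleton_space (R : realType) : metric_space R :=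
  @MetricSpace R unit (fun _ _ => 0) (fun=> erefl) (@singleton_positivity R)
    (fun _ _ => erefl) (fun _ _ _ => singleton_triangle R).

Lemma singleton_real_tree (R : realType) : is_real_tree (singleton_space R).
Proof.
have uniqx (x y : singleton_space R) : x = y by case: x; case: y.
have d0 (x y : singleton_space R) : mdist x y = 0.
  by rewrite (uniqx x y) mdistxx.
have geo (x y : singleton_space R) f : is_geodesic x y f.
  split=> // s t; rewrite d0 !in_itv/= => /le_anti <- /le_anti <-.
  by rewrite d0 subrr normr0.
split=> [x y|q _ qi].
  by split=> [|f g _ _ s _ //]; exists (fun=> x).
have := qi 0 1; rewrite !in_itv/= !lexx ler01 => /(_ isT isT (uniqx _ _)).
by move/esym/eqP; rewrite oner_eq0.
Qed.

Lemma singleton_complete (R : realType) : is_complete (singleton_space R).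
Proof.
move=> F FF _; exists tt => A /nbhs_singleton At.
by apply: filterS filterT => -[].
Qed.

Lemma singleton_locally_compact (R : realType) :
  locally_compact [set: singleton_space R].
Proof.
move=> x _; exists setT; first exact: filterT.
split=> // F FF _; exists tt; split=> // A B FA /nbhs_singleton Bt.
have [y Ay] := filter_ex FA.
by exists tt; split => //; case: y Ay.
Qed.

Definition singleton_tree (R : realType) : clcr_tree R :=
  @ClcrTree R (singleton_space R) tt (@singleton_real_tree R)
    (@singleton_complete R) (@singleton_locally_compact R).

HB.instance Definition _ (R : realType) :=
  isPointed.Build (trees R) (tree_class (singleton_tree R)).

Definition borel_trees (R : realType) : set_system (trees R) :=
  <<s @open (trees R) >>.

Lemma borel_trees0 (R : realType) : @borel_trees R set0.
Proof. exact: sigma_algebra0. Qed.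

Lemma borel_treesC (R : realType) (A : set (trees R)) :
  borel_trees A -> borel_trees (~` A).
Proof. exact: sigma_algebraC. Qed.

Lemma borel_treesU (R : realType) (F : (set (trees R))^nat) :
  (forall i, borel_trees (F i)) -> borel_trees (\bigcup_i F i).
Proof. exact: sigma_algebra_bigcup. Qed.

HB.instance Definition _ (R : realType) :=
  @isMeasurable.Build default_measure_display (trees R) (@borel_trees R)
    (@borel_trees0 R) (@borel_treesC R) (@borel_treesU R).

Definition erased_tree (R : realType) (h : R) (T : clcr_tree R) : set T :=
  [set tree_root T] `|`
  [set x | exists y, segment (tree_root T) y x /\ h <= mdist x y].
Arguments erased_tree {R} h T.

(* [fset_set] returns the empty set on infinite sets; the levels of the erased
   tree are finite when 0 < h. *)
Definition tree_level_count (R : realType) (h a : R) (T : clcr_tree R) : nat :=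
  #|` fset_set (erased_tree h T `&` [set x | mdist (tree_root T) x = a]) |.

Definition level_count (R : realType) (h a : R) (t : trees R) : nat :=
  tree_level_count h a (tree_repr t).

Definition level_count_right (R : realType) (h a : R) (t : trees R) : nat :=
  lim (level_count h b t @[b --> a^'+]).

(* [mu j] stands for a measure on the Borel sigma-field of E, so its value is
   only meaningful on Borel sets. Compact sets are Borel when E is separated. *)
Definition tight (R : realType) (E : topologicalType) (J : Type)
    (mu : J -> set E -> \bar R) : Prop :=
  forall e : R, 0 < e -> exists K : set E,
    [/\ compact K, <<s @open E >> K & forall j, (mu j (~` K) <= e%:E)%E].

(* Main.v *)
Require Import Defs.
From mathcomp Require Import all_boot all_order all_algebra finmap.
From mathcomp Require Import lra.
From mathcomp Require Import all_classical all_reals all_analysis.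

(* Real trees are exactly the geodesic spaces satisfying the four-point
   condition, which passes to limits. Hence a set of trees in which, for all s
   and r, the number of r-separated points of height less than s is bounded by
   a constant is relatively compact: along an ultrafilter, the distance
   matrices of finite nets of bounded sizes converge, and the completion of the
   limit pseudometric is a CLCR tree to which the trees converge for delta.
   Counting points of the h-erased tree at level a amounts to counting points
   of height at least a + h whose pairwise branch points lie below level a.
   Such points are 2h-separated, so compactness bounds the counts. Conversely,
   slicing a 4h-separated family by height into layers of width h shows that
   its size is at most one plus the sum of the counts at the levels h, 2h, 3h,
   etc. The counts at a and at a+ are compared by halving h and moving a up by
   h / 2. *)

Set Implicit Arguments.
Unset Strict Implicit.
Unset Printing Implicit Defensive.

Import Order.TTheory GRing.Theory Num.Theory.
Import numFieldNormedType.Exports.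

Local Open Scope classical_set_scope.
Local Open Scope ring_scope.

(** The axioms of a real tree quantify over injective paths and cannot be passed to a limit
    directly, whereas the four-point condition and approximate interpolation only involve finitely
    many distances. The same concern shapes [spread] and [packing]: the points of an erased tree are
    fragile under a small change of the tree, but finite families subject to strict inequalities on
    distances are carried along by correspondences of small distortion, and hence define open sets
    for delta. The counts are measurable because they are expressed with countably many such open
    sets. Ultrafilters take the place of diagonal extractions: all distances in all nets converge at
    once, and a net index that depends on the tree is made constant by a pigeonhole. For tightness
    of the trees, bounds on the counts are imposed for countably many pairs (mesh, level). The pair
    with code p may violate its bound with probability e / 2^(p+1), so that the violations together
    have probability at most e. *)

(** * Four-point metric spaces and real trees *)

Section metric_topology.
Context {R : realType} (T : metricType R).
Implicit Types (x y : T) (A : set T).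

Lemma mdist_nbhsP x A :
  nbhs x A <-> exists2 e : R, 0 < e & forall y, mdist x y < e -> A y.
Proof.
rewrite -nbhs_ballE; split=> -[e e0 eA]; exists e => //.
  by move=> y xy; apply: eA; rewrite ballEmdist.
by move=> y; rewrite ballEmdist; exact: eA.
Qed.

Lemma mdist_openP A : open A <->
  forall x, A x -> exists2 e : R, 0 < e & forall y, mdist x y < e -> A y.
Proof.
rewrite openE; split => oA x /oA /=; first by move/mdist_nbhsP.
by move=> ?; apply/mdist_nbhsP.
Qed.

Lemma mdist_closedP A : closed A <->
  forall x, (forall e : R, 0 < e -> exists2 y, A y & mdist x y < e) -> A x.
Proof.
split=> [cA x Ax|cA x clx].
  apply: cA => B /mdist_nbhsP[e e0 eB].
  by have [y Ay xy] := Ax _ e0; exists y; split => //; exact: eB.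
apply: cA => e e0.
have [|y [Ay xy]] := clx [set y | mdist x y < e]; last by exists y.
by apply/mdist_nbhsP; exists e.
Qed.

Lemma mdist_cvgP (F : set_system T) x : Filter F ->
  (F --> x) <-> forall e : R, 0 < e -> F [set y | mdist x y < e].
Proof.
move=> FF; split=> [Fx e e0|FA A /mdist_nbhsP[e e0 eA]].
  by apply: Fx; apply/mdist_nbhsP; exists e.
by apply: filterS (FA _ e0) => y; exact: eA.
Qed.

Lemma mdist_cauchyP (F : set_system T) : ProperFilter F ->
  (cauchy F) <->
  forall e : R, 0 < e -> exists x, F [set y | mdist x y < e].
Proof.
move=> FF; split => [/cauchyP cF e e0|cF].
  by have [x] := cF _ e0; rewrite ballEmdist; exists x.
by apply/cauchyP => e e0; have [x xF] := cF _ e0; exists x; rewrite ballEmdist.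
Qed.

Lemma mdist_eq0 x y : mdist x y <= 0 -> x = y.
Proof.
by move=> xy; apply: mdist_positivity; apply/eqP; rewrite eq_le xy mdist_ge0.
Qed.

End metric_topology.

(** * From the four-point condition to the real tree axioms *)

Section four_point_spaces.
Context {R : realType} (T : metricType R).
Implicit Types (x y z w r c : T).

(** Gromov's 0-hyperbolicity: of the three sums over pairings of four points, the two largest
    agree. *)
Definition four_point := forall x y z w,
  mdist x y + mdist z w <=
  Num.max (mdist x z + mdist y w) (mdist x w + mdist y z).

(** Geodesicity stated point by point, a form that can be reached from approximate interpolants
    ([approx_interpolable]). *)
Definition interpolable := forall x y (s : R), 0 <= s <= mdist x y ->
  exists z, mdist x z = s /\ mdist z y = mdist x y - s.

(* Twice the Gromov product: in a tree, twice the distance from r to the branch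
   point of x and y. *)
Definition gprod r x y := mdist r x + mdist r y - mdist x y.

Lemma gprodC r x y : gprod r x y = gprod r y x.
Proof. by rewrite /gprod (metric_sym x y) addrAC addrC addrA addrAC. Qed.

Lemma gprodxx r x : gprod r x x = 2 * mdist r x.
Proof. by rewrite /gprod mdistxx; lra. Qed.

Lemma gprod_le r x y : gprod r x y <= 2 * mdist r x.
Proof. by have := metric_triangle r x y; rewrite /gprod; lra. Qed.

Lemma gprod_ge0 r x y : 0 <= gprod r x y.
Proof.
by have := metric_triangle x r y; rewrite /gprod (metric_sym x r); lra.
Qed.

Hypothesis T4 : four_point.

(** The four-point condition at [x], [z], [y], [r] is the ultrametric inequality for Gromov
    products: seen from [r], sharing an initial part of given length is transitive. *)
Lemma gprod_ultra r x y z (m : R) :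
  m <= gprod r x y -> m <= gprod r y z -> m <= gprod r x z.
Proof.
have := T4 x z y r; rewrite /gprod (metric_sym z y) (metric_sym z r)
  (metric_sym x r) (metric_sym y r) le_max => /orP[]; lra.
Qed.

Lemma gprod_ultra_lt r x y z (m : R) :
  m < gprod r x y -> m < gprod r y z -> m < gprod r x z.
Proof.
have := T4 x z y r; rewrite /gprod (metric_sym z y) (metric_sym z r)
  (metric_sym x r) (metric_sym y r) le_max => /orP[]; lra.
Qed.

Lemma interpolant_unique x y z z' : mdist x z = mdist x z' ->
  mdist x z + mdist z y = mdist x y -> mdist x z' + mdist z' y = mdist x y ->
  z = z'.
Proof.
move=> xz zy z'y; apply: mdist_eq0.
have := T4 z z' x y; rewrite (metric_sym z x) (metric_sym z' x) le_max.
by move=> /orP[]; lra.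
Qed.

Lemma geodesic_interpolates x y f (s : R) : is_geodesic x y f ->
  s \in `[0, mdist x y] -> mdist x (f s) = s /\ mdist (f s) y = mdist x y - s.
Proof.
move=> [f0 f1 fd] sxy; have := sxy; rewrite in_itv/= => /andP[s0 s1].
have z0 : 0 \in `[0, mdist x y] by rewrite in_itv/= lexx mdist_ge0.
have z1 : mdist x y \in `[0, mdist x y] by rewrite in_itv/= lexx mdist_ge0.
split; first by rewrite -{1}f0 fd// sub0r normrN ger0_norm.
by rewrite -{1}f1 fd// ler0_norm ?subr_le0// opprB.
Qed.

Hypothesis Tint : interpolable.

(** Points chosen independently at each distance from [x] already form an isometry: the four-point
    condition bounds [mdist (f s) (f t)] by t - s from above, the triangle inequality from below. *)
Lemma geodesic_exists x y : exists f, is_geodesic x y f.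
Proof.
have /choice[f fP] : forall s : R, exists z, 0 <= s <= mdist x y ->
    mdist x z = s /\ mdist z y = mdist x y - s.
  move=> s; case: (boolP (0 <= s <= mdist x y)) => [/Tint[z zs]|_].
    by exists z.
  by exists x.
have fle (s t : R) : 0 <= s -> s <= t -> t <= mdist x y ->
    mdist (f s) (f t) = t - s.
  move=> s0 st txy.
  have [|xs sy] := fP s; first by rewrite s0 (le_trans st).
  have [|xt ty] := fP t; first by rewrite txy (le_trans s0).
  have := metric_triangle x (f s) (f t).
  have := T4 (f s) (f t) x y.
  rewrite (metric_sym (f s) x) (metric_sym (f t) x) le_max.
  by move=> /orP[]; lra.
exists f; split.
- have [|xs _] := fP 0; first by rewrite lexx mdist_ge0.
  by apply/esym/mdist_eq0; rewrite xs.
- have [|_ sy] := fP (mdist x y); first by rewrite lexx mdist_ge0.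
  by apply/mdist_eq0; rewrite sy subrr.
- move=> s t; rewrite !in_itv/= => /andP[s0 s1] /andP[t0 t1].
  have [st|/ltW ts] := leP s t.
    by rewrite fle// ler0_norm ?subr_le0// opprB.
  by rewrite metric_sym fle// ger0_norm ?subr_ge0.
Qed.

Lemma segmentP x y z :
  segment x y z <-> mdist x z + mdist z y = mdist x y.
Proof.
split=> [[f fg [s /= sxy <-]]|xzy].
  by have [-> ->] := geodesic_interpolates fg sxy; lra.
have [f fg] := geodesic_exists x y; exists f => //.
have zxy : mdist x z \in `[0, mdist x y].
  rewrite in_itv/= mdist_ge0/=; have := mdist_ge0 z y; lra.
exists (mdist x z) => //; have [fz1 fz2] := geodesic_interpolates fg zxy.
by apply: (@interpolant_unique x y) => //; lra.
Qed.

(* Removing the point c of the segment [a, b] disconnects a from b: the sets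
   {z | gprod c a z > 0} and {z | z != c and gprod c a z = 0} are both open. *)
Lemma connected_through_segment (A : set T) a b c : connected A ->
  A a -> A b -> mdist a c + mdist c b = mdist a b -> A c.
Proof.
move=> cA Aa Ab acb; apply: contrapT => nAc.
have neq z : A z -> 0 < mdist c z.
  by move=> Az; rewrite mdist_gt0; apply: contra_notN nAc => /eqP ->.
have near z z' : mdist z z' < mdist c z -> 0 < gprod c z z'.
  by move=> zz'; have := mdist_ge0 c z'; rewrite /gprod; lra.
pose C := [set z | 0 < gprod c a z].
pose D := [set z | 0 < mdist c z /\ gprod c a z <= 0].
have CA : A `&` C = A.
  apply: cA.
  - by exists a; split => //; rewrite /C/= gprodxx; have := neq _ Aa; lra.
  - exists C => //; apply/mdist_openP => z Cz; exists (mdist c z).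
      rewrite mdist_gt0; apply: contraPneq Cz => <-.
      by rewrite /C/= /gprod mdistxx metric_sym; lra.
    by move=> z' /near zz'; apply: gprod_ultra_lt zz'.
  - exists (~` D).
      apply: open_closedC; apply/mdist_openP => z [cz az].
      exists (mdist c z) => // z' zz'.
      split; last first.
        rewrite leNgt; apply: contraTN az => az'; rewrite -ltNge.
        by apply: gprod_ultra_lt az' _; rewrite gprodC; exact: near.
      by have := metric_triangle c z' z; rewrite (metric_sym z'); lra.
    apply/seteqP; split => z [Az]; rewrite /C/D/= => Cz; split => //.
      by move=> [_]; lra.
    by rewrite ltNge; apply/negP => ?; apply: Cz; split => //; exact: neq.
have : (A `&` C) b by rewrite CA.
by rewrite /C => -[_ /=]; rewrite /gprod (metric_sym c a); lra.
Qed.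

(** Connectedness shows that a path covers the segment. Conversely, a point [p'] of an injective
    path has a projection [m] on the segment, which the path visits both before and after [p'];
    injectivity then identifies [p'] with [m]. *)
Lemma four_point_real_tree : is_real_tree T.
Proof.
split=> [x y|q qc qi].
  split=> [|f g fg gg s sxy]; first exact: geodesic_exists.
  have [f1 f2] := geodesic_interpolates fg sxy.
  have [g1 g2] := geodesic_interpolates gg sxy.
  by apply: (@interpolant_unique x y); lra.
have through (s t : R) c : 0 <= s -> s <= t -> t <= 1 ->
    mdist (q s) c + mdist c (q t) = mdist (q s) (q t) ->
    exists2 u, s <= u <= t & q u = c.
  move=> s0 st t1 sct.
  have : (q @` `[s, t]) c.
    apply: connected_through_segment sct.
    - apply: connected_continuous_connected; first exact: segment_connected.
      apply: continuous_subspaceW qc => u /=; rewrite !in_itv/= => /andP[su ut].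
      by rewrite (le_trans s0)//= (le_trans ut).
    - by exists s => //=; rewrite in_itv/= lexx.
    - by exists t => //=; rewrite in_itv/= lexx st.
  by move=> [u /=]; rewrite in_itv/= => ? <-; exists u.
apply/seteqP; split=> [p [t /=]|c /segmentP/through]; last first.
  move=> /(_ (lexx _) ler01 (lexx _))[u u01 <-].
  by exists u => //=; rewrite in_itv.
rewrite in_itv/= => /andP[t0 t1] <-.
apply/segmentP; set a := q 0; set b := q 1; set p' := q t.
have g0 := gprod_ge0 a p' b.
(* Half the Gromov product is the height, above [a], of the branch point of [p'] and [b]. This point
   of [a, p'] is next identified with the point [m'] of [a, b] at the same height, by chaining
   [gprod_ultra] through [p'] and [b]. *)
have [|m [am mp]] := Tint (x := a) (y := p') (s := gprod a p' b / 2).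
  by have := gprod_le a p' b; lra.
have apmb : mdist a m + mdist m b <= mdist a b.
  have [|m' [am' mb]] := Tint (x := a) (y := b) (s := gprod a p' b / 2).
    by have := gprod_le a b p'; rewrite gprodC; lra.
  suff -> : m = m' by lra.
  apply: mdist_eq0.
  have mp' : gprod a p' b <= gprod a m p'.
    by rewrite [leRHS]/gprod; lra.
  have mb' : gprod a p' b <= gprod a b m'.
    by rewrite [leRHS]/gprod (metric_sym b m'); lra.
  have := gprod_ultra (gprod_ultra mp' (lexx _)) mb'.
  by rewrite [leRHS]/gprod; lra.
have tri := metric_triangle a m b; have tri' := metric_triangle p' m b.
have gE : mdist p' m = mdist a p' - gprod a p' b / 2 by rewrite metric_sym mp.
have [u /andP[u0 ut] um] : exists2 u, 0 <= u <= t & q u = m.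
  by apply: through => //; rewrite -/a -/p'; lra.
have [v /andP[tv v1] vm] : exists2 v, t <= v <= 1 & q v = m.
  apply: through => //; rewrite -/b -/p' gE.
  by move: am mp gE; rewrite /gprod; lra.
have uv : u = v.
  apply: qi; rewrite ?in_itv/= ?um ?vm// ?u0 ?v1 ?andbT/=.
    exact: le_trans ut t1.
  exact: le_trans t0 tv.
have ut' : u = t by apply/le_anti; rewrite ut uv.
by rewrite /p' -ut' um; lra.
Qed.

End four_point_spaces.

(** * From the real tree axioms to the four-point condition *)

Section real_trees.
Context {R : realType} (T : metricType R).
Implicit Types (x y z w c : T).
Hypothesis Ttree : is_real_tree T.

Lemma real_tree_interpolable : interpolable T.
Proof.
move=> x y s sxy; have [[f fg] _] := Ttree.1 x y; exists (f s).
by apply: geodesic_interpolates fg _; rewrite in_itv.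
Qed.

Lemma lipschitz_path_continuous (q : R -> T) (k : R) :
  {in `[0, 1] &, forall u v, mdist (q u) (q v) <= k * `|u - v|} ->
  {within `[0, 1], continuous q}.
Proof.
move=> ql; apply/subspace_continuousP => u u01.
apply/mdist_cvgP => e e0.
have k0 : 0 < `|k| + 1 by rewrite ltr_wpDl.
have : \forall v \near u, `|u - v| < e / (`|k| + 1).
  by apply: (@nbhsx_ballx _ _ u); rewrite divr_gt0.
apply: filterS => v uv v01 /=; apply: le_lt_trans (ql _ _ u01 v01) _.
apply: le_lt_trans (_ : (`|k| + 1) * `|u - v| < e).
  by rewrite ler_wpM2r// (le_trans (ler_norm k))// lerDl.
by rewrite mulrC -ltr_pdivlMr.
Qed.

(* Two geodesics issued from x share an initial part [x, c] and then separate;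
   running back along the first one from y to c and then along the second one
   gives an injective path, which is the segment [y, z]. *)
Lemma real_tree_median x y z : exists c,
  [/\ mdist x c + mdist c y = mdist x y, mdist x c + mdist c z = mdist x z &
      mdist y c + mdist c z = mdist y z].
Proof.
have [[f fg] _] := Ttree.1 x y; have [[g gg] _] := Ttree.1 x z.
(* The supremum [t0] is the last height at which the two geodesics meet; it is attained because both
   are isometric. *)
pose E := [set t : R | [/\ 0 <= t, t <= mdist x y, t <= mdist x z & f t = g t]].
have E0 : E 0.
  by split; rewrite ?mdist_ge0//; have [-> _ _] := fg; have [-> _ _] := gg.
have supE : has_sup E by split; [exists 0|exists (mdist x y) => t []].
pose t0 := sup E.
have t00 : 0 <= t0 by apply: ub_le_sup => //; case: supE.
have t0y : t0 <= mdist x y by apply: ge_sup; [exists 0|move=> t []].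
have t0z : t0 <= mdist x z by apply: ge_sup; [exists 0|move=> t []].
have fd (s t : R) : 0 <= s -> 0 <= t -> s <= mdist x y -> t <= mdist x y ->
    mdist (f s) (f t) = `|s - t|.
  by have [_ _ h] := fg => *; apply: h; rewrite in_itv/=; apply/andP.
have gd (s t : R) : 0 <= s -> 0 <= t -> s <= mdist x z -> t <= mdist x z ->
    mdist (g s) (g t) = `|s - t|.
  by have [_ _ h] := gg => *; apply: h; rewrite in_itv/=; apply/andP.
have fI (t : R) : 0 <= t -> t <= mdist x y ->
    mdist x (f t) = t /\ mdist (f t) y = mdist x y - t.
  by move=> ? ?; apply: geodesic_interpolates fg _; rewrite in_itv/=;
    apply/andP.
have gI (t : R) : 0 <= t -> t <= mdist x z ->
    mdist x (g t) = t /\ mdist (g t) z = mdist x z - t.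
  by move=> ? ?; apply: geodesic_interpolates gg _; rewrite in_itv/=;
    apply/andP.
have fgt0 : f t0 = g t0.
  apply: mdist_eq0; apply/ler_addgt0Pl => e e0; rewrite addr0.
  have [|t [t0' ty tz ftg] tt0] := sup_adherent (eps := e / 2) _ supE.
    by rewrite divr_gt0.
  have tle : t <= t0 by apply: ub_le_sup => //; case: supE.
  rewrite -/t0 in tt0.
  have := metric_triangle (f t0) (f t) (g t0); rewrite fd//.
  rewrite ftg gd// ger0_norm ?ler0_norm ?subr_le0 ?subr_ge0//; lra.
have sep t : t0 < t -> t <= mdist x y -> t <= mdist x z -> f t <> g t.
  move=> t0t ty tz ftg; have : t <= t0; last by rewrite leNgt t0t.
  by apply: ub_le_sup; [case: supE|split => //; lra].
exists (f t0).
have [f1 f2] := fI _ t00 t0y; have [g1 g2] := gI _ t00 t0z.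
rewrite f1 f2; split; [lra|by rewrite fgt0 g2; lra|].
have [yE|ty] := eqVneq t0 (mdist x y).
  have -> : f t0 = y by apply: mdist_eq0; rewrite f2 yE subrr.
  by rewrite mdistxx add0r.
have [zE|tz] := eqVneq t0 (mdist x z).
  have -> : f t0 = z by apply: mdist_eq0; rewrite fgt0 g2 zE subrr.
  by rewrite mdistxx addr0.
have {ty}a0 : 0 < mdist x y - t0 by rewrite subr_gt0 lt_neqAle ty.
have {tz}b0 : 0 < mdist x z - t0 by rewrite subr_gt0 lt_neqAle tz.
pose a := mdist x y - t0; pose b := mdist x z - t0.
rewrite -/a in a0; rewrite -/b in b0.
(* Parametrized by [-a, b] with the separation point at 0: negative times run along [f] down from
   [y], positive ones along [g] up to [z]. *)
pose Q (v : R) := if v <= 0 then f (t0 - v) else g (t0 + v).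
have Qc (v : R) : -a <= v -> v <= b -> mdist (Q v) (f t0) = `|v|.
  move=> va vb; rewrite /Q; case: leP => v0.
    by rewrite -[RHS]normrN fd//; [congr (`|_|); lra|..]; move: va vb;
      rewrite /a/b; lra.
  by rewrite fgt0 gd//; [congr (`|_|); lra|..]; move: va vb; rewrite /a/b; lra.
have Ql (v w : R) : -a <= v -> v <= w -> w <= b -> mdist (Q v) (Q w) <= w - v.
  move=> va vw wb.
  have [w0|w0] := leP w 0.
    rewrite /Q w0 (le_trans vw w0) fd//; try by move: va wb; rewrite /a/b; lra.
    by rewrite ger0_norm; lra.
  have [v0|v0] := leP v 0; last first.
    rewrite /Q !leNgt w0 v0/= gd//; try by move: va wb; rewrite /a/b; lra.
    by rewrite ler0_norm; lra.
  have := metric_triangle (Q v) (f t0) (Q w).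
  rewrite (metric_sym (f t0)) !Qc ?(ger0_norm (ltW w0)) ?(ler0_norm v0); lra.
(* If the two halves met, it would be at equal distances from [x], hence at a height beyond [t0]
   where [f] and [g] agree. *)
have Qi (v w : R) : -a <= v -> v < w -> w <= b -> Q v = Q w -> False.
  move=> va vw wb QQ.
  have [w0|w0] := leP w 0.
    have : mdist (Q v) (Q w) = 0 by rewrite QQ mdistxx.
    rewrite /Q w0 (le_trans (ltW vw) w0) fd//; try by move: va wb;
      rewrite /a/b; lra.
    by rewrite ger0_norm; lra.
  have [v0|v0] := leP v 0; last first.
    have : mdist (Q v) (Q w) = 0 by rewrite QQ mdistxx.
    rewrite /Q !leNgt w0 v0/= gd//; try by move: va wb; rewrite /a/b; lra.
    by rewrite ler0_norm; lra.
  move: QQ; rewrite /Q v0 leNgt w0/= => fgE.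
  have [|//|f1' _] := fI (t0 - v); [lra|by move: va; rewrite /a; lra|].
  have [|//|g1' _] := gI (t0 + w); [lra|by move: wb; rewrite /b; lra|].
  have vwE : t0 - v = t0 + w by rewrite -f1' fgE g1'.
  apply: (sep (t0 + w)); [lra| |by move: wb; rewrite /b; lra|].
    by move: va; rewrite /a; lra.
  by rewrite -fgE vwE.
pose q (u : R) := Q (u * (a + b) - a).
have ab0 : 0 < a + b by lra.
have qab (u : R) : 0 <= u -> u <= 1 ->
  -a <= u * (a + b) - a /\ u * (a + b) - a <= b.
  move=> u0 u1; split; first by rewrite lerBrDl subrr mulr_ge0// ltW.
  by rewrite lerBlDr (addrC b) ler_piMl// ltW.
have qle (u v : R) : 0 <= u -> u <= v -> v <= 1 ->
    mdist (q u) (q v) <= (a + b) * (v - u).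
  move=> u0 uv v1; have [? ?] := qab _ u0 (le_trans uv v1).
  have [? ?] := qab _ (le_trans u0 uv) v1.
  apply: le_trans (Ql _ _ _ _ _) _ => //.
    by rewrite lerD2r ler_wpM2r// ltW.
  by rewrite le_eqVlt; apply/orP; left; apply/eqP; lra.
have qcont : {within `[0, 1], continuous q}.
  apply: (@lipschitz_path_continuous _ (a + b)) => u v.
  rewrite !in_itv/= => /andP[u0 u1] /andP[v0 v1].
  have [uv|/ltW uv] := leP u v.
    by rewrite ler0_norm ?subr_le0// opprB qle.
  by rewrite metric_sym ger0_norm ?subr_ge0// qle.
have qinj : {in `[0, 1] &, injective q}.
  move=> u v; rewrite !in_itv/= => /andP[u0 u1] /andP[v0 v1] quv.
  have [? ?] := qab _ u0 u1; have [? ?] := qab _ v0 v1.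
  have [uv|uv|//] := ltgtP u v.
    by exfalso; apply: (Qi _ _ _ _ _ quv) => //; rewrite ltrD2r ltr_pM2r.
  by exfalso; apply: (Qi _ _ _ _ _ (esym quv)) => //; rewrite ltrD2r ltr_pM2r.
have q0 : q 0 = y.
  rewrite /q mul0r sub0r /Q oppr_le0 (ltW a0) opprK.
  by apply: mdist_eq0; rewrite /a addrC subrK (fI _ (mdist_ge0 _ _) _).2 ?subrr.
have q1 : q 1 = z.
  rewrite /q mul1r addrAC subrr add0r /Q leNgt b0/=.
  by apply: mdist_eq0; rewrite /b addrC subrK (gI _ (mdist_ge0 _ _) _).2 ?subrr.
have : (q @` `[0, 1]) (f t0).
  exists (a / (a + b)).
    rewrite /= in_itv/= divr_ge0 ?(ltW a0) ?(ltW ab0)//=.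
    by rewrite ler_pdivrMr// mul1r lerDl ltW.
  by rewrite /q divfK ?gt_eqF// subrr /Q lexx subr0.
rewrite (Ttree.2 _ qcont qinj) q0 q1 => -[k kg [s /= syz <-]].
by have [-> ->] := geodesic_interpolates kg syz; lra.
Qed.

(** Uniqueness comes here from the axiom on geodesics: concatenating geodesics from [x] to [w] and
    from [w] to [y] gives one from [x] to [y], so [w] is determined by its distance to [x]. *)
Lemma real_tree_unique x y z z' : mdist x z = mdist x z' ->
  mdist x z + mdist z y = mdist x y -> mdist x z' + mdist z' y = mdist x y ->
  z = z'.
Proof.
move=> xz zy z'y.
have [[f fg] fu] := Ttree.1 x y.
suff seg w : mdist x w + mdist w y = mdist x y -> w = f (mdist x w).
  by rewrite (seg z)// xz -(seg z').
move=> xwy.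
have [[g gg] _] := Ttree.1 x w; have [[k kg] _] := Ttree.1 w y.
have w0 := mdist_ge0 x w; have wy0 := mdist_ge0 w y.
pose p (t : R) := if t <= mdist x w then g t else k (t - mdist x w).
have pw : p (mdist x w) = w by rewrite /p lexx; have [_ ->] := gg.
have pg : is_geodesic x y p.
  have p1 (s : R) : mdist x w <= s -> p s = k (s - mdist x w).
    move=> ws; rewrite /p; case: (leP s) => // sw;
      have -> : s = mdist x w by apply/le_anti; rewrite sw ws.
    by rewrite subrr; have [-> _ _] := kg; have [_ -> _] := gg.
  have px (s : R) : 0 <= s -> s <= mdist x w -> mdist x (p s) = s /\
      mdist (p s) w = mdist x w - s.
    move=> s0 sw; rewrite /p sw; apply: geodesic_interpolates gg _.
    by rewrite in_itv/= s0.
  have py (s : R) : mdist x w <= s -> s <= mdist x y ->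
      mdist w (p s) = s - mdist x w /\ mdist (p s) y = mdist x y - s.
    move=> ws sy; rewrite p1//.
    have [|-> ->] := geodesic_interpolates (s := s - mdist x w) kg.
      by rewrite in_itv/=; apply/andP; split; lra.
    by split; lra.
  have pd (s t : R) : 0 <= s -> s <= t -> t <= mdist x y ->
    mdist (p s) (p t) = t - s.
    move=> s0 st ty.
    have [tw|wt] := leP t (mdist x w).
      have [_ _ gd] := gg; rewrite /p tw (le_trans st tw) gd.
      - by rewrite ler0_norm; lra.
      - by rewrite in_itv/= s0 (le_trans st).
      - by rewrite in_itv/= tw (le_trans s0).
    have [sw|ws] := leP s (mdist x w); last first.
      have [_ _ kd] := kg; rewrite !p1 ?(ltW ws) ?(ltW wt)// kd.
      - by rewrite ler0_norm; lra.
      - by rewrite in_itv/=; apply/andP; split; lra.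
      - by rewrite in_itv/=; apply/andP; split; lra.
    have [px1 px2] := px _ s0 sw; have [py1 py2] := py _ (ltW wt) ty.
    have := metric_triangle (p s) w (p t).
    have := metric_triangle x (p s) y; have := metric_triangle (p s) (p t) y;
      lra.
  split.
  - by apply/esym/mdist_eq0; rewrite (px _ (lexx _) w0).1.
  - have wy : mdist x w <= mdist x y by lra.
    by apply/mdist_eq0; rewrite (py _ wy (lexx _)).2 subrr.
  - move=> s t; rewrite !in_itv/= => /andP[s0 s1] /andP[t0 t1].
    have [st|/ltW ts] := leP s t.
      by rewrite pd// ler0_norm ?subr_le0// opprB.
    by rewrite metric_sym pd// ger0_norm ?subr_ge0.
rewrite -{1}pw; apply: fu => //; rewrite in_itv/= w0/=; lra.
Qed.

Lemma real_tree_four_point : four_point T.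
Proof.
move=> x z y w.
have [a [wa1 wa2 wa3]] := real_tree_median w x y.
have [b [wb1 wb2 wb3]] := real_tree_median w z y.
(* m is the smaller of the two Gromov products: the three geodesics from w
   agree up to height m. *)
pose m := Num.min (mdist w a) (mdist w b).
have m0 : 0 <= m by rewrite /m le_min !mdist_ge0.
have [|p [wp pa]] := real_tree_interpolable (x := w) (y := a) (s := m).
  by rewrite m0/= /m ge_min lexx.
have [|p' [wp' pb]] := real_tree_interpolable (x := w) (y := b) (s := m).
  by rewrite m0/= /m ge_min lexx orbT.
have on u v t : mdist w u + mdist u v = mdist w v ->
    mdist w t + mdist t u = mdist w u -> mdist w t + mdist t v = mdist w v.
  move=> wuv wtu; have := metric_triangle w t v.
  by have := metric_triangle t u v; lra.
have py : mdist w p + mdist p y = mdist w y by apply: on wa2 _; lra.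
have p'y : mdist w p' + mdist p' y = mdist w y by apply: on wb2 _; lra.
have pp' : p = p' by apply: (real_tree_unique (x := w) (y := y)) => //;
  rewrite wp wp'.
have px : mdist w p + mdist p x = mdist w x by apply: on wa1 _; lra.
have pz : mdist w p + mdist p z = mdist w z by apply: on wb1 _; rewrite pp';
  lra.
have := metric_triangle x p z; rewrite (metric_sym x p).
rewrite (metric_sym x w) (metric_sym z w) (metric_sym y w).
rewrite (metric_sym x a) in wa3; rewrite (metric_sym z b) in wb3.
rewrite le_max => xz; apply/orP.
have [ab|ba] := leP (mdist w a) (mdist w b); [left|right].
  by rewrite /m (min_idPl ab) in wp; lra.
by rewrite /m (min_idPr (ltW ba)) in wp; lra.
Qed.

End real_trees.

(** * Compactness in metric spaces *)

(** The ultrafilter pigeonhole. It serves to fix the index of a net point when that index depends on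
    the tree. *)
Lemma ultra_finite_exists (U : Type) (I : finType) (F : set_system U)
    (Q : I -> set U) : UltraFilter F ->
  F [set x | exists i, Q i x] -> exists i, F (Q i).
Proof.
move=> UF FQ; apply: contrapT => nQ.
have /filter_forall nF i : F (~` Q i).
  by have [Fi|//] := in_ultra_setVsetC (Q i) UF; case: nQ; exists i.
by have [x [[i Qix] /(_ i)]] := filter_ex (filterI FQ nF).
Qed.

Section compactness.
Context {R : realType} (T : metricType R).
Implicit Types (x y z r : T) (A B : set T).

Definition totally_bounded A := forall e : R, 0 < e ->
  exists s : seq T, forall x, A x -> exists2 y, y \in s & mdist y x < e.

Lemma totally_boundedS A B : A `<=` B -> totally_bounded B -> totally_bounded A.
Proof.
by move=> AB tB e /tB[s sB]; exists s => x /AB; exact: sB.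
Qed.

Lemma compact_finite_radius_cover A (rad : T -> R) : compact A ->
  (forall x, A x -> 0 < rad x) ->
  exists s : seq T, forall x, A x ->
    exists y, [/\ y \in s, A y & mdist y x < rad y].
Proof.
move=> /compact_near_coveringP cA rad0.
(* Finite lists directed by inclusion: near this filter a list contains any prescribed point, so the
   near-covering form of compactness returns one list serving all of [A]. *)
pose F := filter_from setT (fun s : seq T => [set s' :
  seq T | {subset s <= s'}]).
have FF : ProperFilter F.
  apply: filter_from_proper; last by move=> s _; exists s.
  apply: filter_from_filter; first by exists [::].
  move=> s s' _ _; exists (s ++ s') => // t st.
  by split=> x xs; apply: st; rewrite mem_cat xs ?orbT.
have : \near F, A `<=`
    (fun s x => exists y, [/\ y \in s, A y & mdist y x < rad y]) F.
  apply: cA => x Ax.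
  exists ([set x' | mdist x x' < rad x], [set s | x \in s]).
    split => /=; first by apply/mdist_nbhsP; exists (rad x) => //; exact: rad0.
    by exists [:: x] => // s xs; apply: xs; rewrite inE.
  by move=> [x' s]/= [xx' xs]; exists x.
by move=> /filter_ex[s sA]; exists s => x /sA.
Qed.

Lemma compact_totally_bounded A : compact A -> totally_bounded A.
Proof.
move=> cA e e0.
have [s sA] := compact_finite_radius_cover (rad := fun=> e) cA (fun _ _ => e0).
by exists s => x /sA[y [ys _ yx]]; exists y.
Qed.

Lemma totally_bounded_compact A : is_complete T -> closed A ->
  totally_bounded A -> compact A.
Proof.
move=> cT cA tA; rewrite compact_ultra => F UF FA.
have [|x Fx] := cT F _.
  apply/mdist_cauchyP => e /tA[s sA].
  have : F [set x | exists i : 'I_(size s), mdist (tnth (in_tuple s) i) x < e].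
    apply: filterS FA => x /sA[y ys yx].
    have si : (index y s < size s)%N by rewrite index_mem.
    by exists (Ordinal si); rewrite (tnth_nth y)/= nth_index.
  by move=> /ultra_finite_exists[i Fi]; exists (tnth (in_tuple s) i).
exists x; split => //; apply: cA => B /Fx FB.
by have [y [Ay By]] := filter_ex (filterI FA FB); exists y.
Qed.

Lemma closed_mball r (t : R) : closed [set x | mdist r x <= t].
Proof.
apply/mdist_closedP => x xe /=; apply/ler_addgt0Pl => e /xe[y /= ry xy].
by have := metric_triangle r y x; rewrite (metric_sym y); lra.
Qed.

Lemma finite_pos_lower_bound (I : eqType) (s : seq I) (f : I -> R) :
  (forall i, i \in s -> 0 < f i) ->
  exists2 e : R, 0 < e & forall i, i \in s -> e <= f i.
Proof.
elim: s => [|i s ih] f0; first by exists 1.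
have [|e e0 ef] := ih; first by move=> j js; apply: f0; rewrite inE js orbT.
exists (Num.min (f i) e); first by rewrite lt_min e0 f0// mem_head.
move=> j; rewrite inE => /predU1P[->|/ef ej]; first by rewrite ge_min lexx.
by rewrite ge_min ej orbT.
Qed.

(* The Hopf-Rinow-Cohn-Vossen theorem. *)
Lemma totally_bounded_mball : is_complete T -> locally_compact [set: T] ->
  interpolable T -> forall r (t : R), totally_bounded [set x | mdist r x <= t].
Proof.
move=> cT lT iT r t.
pose ball_ (u : R) := [set x | mdist r x <= u].
pose S := [set u : R | totally_bounded (ball_ u)].
have S0 : S 0.
  move=> e e0; exists [:: r] => x /mdist_eq0 <-.
  by exists r; rewrite ?mem_head// mdistxx.
have [[u [Su tu]]|nS] := pselect (exists u, S u /\ t <= u).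
  by apply: totally_boundedS Su => x /= /le_trans; exact.
have supS : has_sup S.
  split; first by exists 0.
  by exists t => u Su; rewrite leNgt; apply: contra_notN nS => /ltW; exists u.
pose s := sup S.
have s0 : 0 <= s by apply: ub_le_sup => //; case: supS.
(* The supremum is reached: a point within [s] of [r] is within e / 2 of a ball of radius [u] with
   [u] in [S]. *)
have Ss : S s.
  move=> e e0; have e20 : 0 < e / 2 by rewrite divr_gt0.
  have [u [Su us u0 su]] : exists u, [/\ S u, u <= s, 0 <= u & s - e / 2 < u].
    have [u Su su] := sup_adherent e20 supS; rewrite -/s in su.
    have us : u <= s by apply: ub_le_sup => //; case: supS.
    have [u0|u0] := leP 0 u; first by exists u.
    by exists 0; split => //; lra.
  have [q qu] := Su _ e20; exists q => x; rewrite /ball_/= => xs.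
  have [xu|ux] := leP (mdist r x) u.
    by have [y yq yx] := qu _ xu; exists y => //; lra.
  have [|z [rz zx]] := iT r x u; first by rewrite u0 ltW.
  have [|y yq yz] := qu z; first by rewrite /ball_/= rz.
  by exists y => //; have := metric_triangle y z x; lra.
have cs : compact (ball_ s).
  exact: totally_bounded_compact (@closed_mball _ _) Ss.
have /choice[K KP] : forall x, exists K : R * set T,
    [/\ 0 < K.1, (forall y, mdist x y < K.1 -> K.2 y) & compact K.2].
  move=> x; have [U] := lT x I.
  by rewrite withinET => /mdist_nbhsP[e e0 eU] [cU _]; exists (e, U).
have [|q qs] := compact_finite_radius_cover (rad := fun x => (K x).1 / 2) cs.
  by move=> x _; rewrite divr_gt0//; case: (KP x).
have [|e e0 eq] := finite_pos_lower_bound (s := q) (f := fun x => (K x).1 / 2).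
  by move=> x _; rewrite divr_gt0//; case: (KP x).
(* The halved radii leave room: a point within s + e / 2 of [r] is within e / 2 of the ball of
   radius [s], hence in one of finitely many compact neighbourhoods. This contradicts the choice of
   [s]. *)
have : S (s + e / 2).
  apply: (@totally_boundedS _ (\big[setU/set0]_(y <- q) (K y).2)).
    move=> x; rewrite /ball_/= -bigcup_seq => xs.
    have [z [rz zx]] : exists z, mdist r z <= s /\ mdist z x <= e / 2.
      have [xs'|sx] := leP (mdist r x) s.
        by exists x; rewrite mdistxx; split => //; lra.
      have [|z [rz zx]] := iT r x s; first by rewrite s0 ltW.
      by exists z; split; lra.
    have [y [yq _ yz]] := qs z rz; exists y => //.
    have [_ + _] := KP y; apply.
    by have := eq _ yq; have := metric_triangle y z x; lra.
  apply: compact_totally_bounded; apply: bigsetU_compact => y _.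
  by case: (KP y).
by move=> /(ub_le_sup (proj2 supS)); rewrite -/s; lra.
Qed.

End compactness.

(** * Completion of a pseudometric *)

(* The completion of a pseudometric D on I, as a space of functions on I: a
   point is represented by its distances to the elements of I. *)
Section completion.
Context {R : realType} (I : Type) (i0 : I) (D : I -> I -> R).
Hypothesis Dxx : forall i, D i i = 0.
Hypothesis Dsym : forall i j, D i j = D j i.
Hypothesis Dtri : forall j i k, D i k <= D i j + D j k.

(** The uniform closure of the functions [D i]. Indices at pseudodistance 0 give the same function,
    so the quotient is built in. *)
Definition completion_carrier : Type := {f : I -> R |
  forall e : R, 0 < e -> exists i, forall j, `|f j - D i j| <= e}.

Definition completion_dist (f g : completion_carrier) : R :=
  sup [set `|sval f j - sval g j| | j in setT].

Implicit Types f g h : completion_carrier.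

Lemma completion_has_sup f g :
  has_sup [set `|sval f j - sval g j| | j in setT].
Proof.
split; first by exists `|sval f i0 - sval g i0|, i0.
have [i fi] := proj2_sig f 1 ltr01; have [k gk] := proj2_sig g 1 ltr01.
exists (1 + D i k + 1) => _ [j _ <-].
have := fi j; have := gk j; have := Dtri k i j; have := Dtri i k j.
rewrite (Dsym k i) => t1 t2; rewrite !ler_norml => /andP[g1 g2] /andP[f1 f2].
by apply/andP; split; lra.
Qed.

Lemma completion_dist_ub f g j : `|sval f j - sval g j| <= completion_dist f g.
Proof. by apply: ub_le_sup; [case: (completion_has_sup f g)|exists j]. Qed.

Lemma completion_dist_le f g (e : R) :
  (forall j, `|sval f j - sval g j| <= e) -> completion_dist f g <= e.
Proof.
by move=> fge; apply: ge_sup;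
  [case: (completion_has_sup f g)|move=> _ [j _ <-]].
Qed.

Lemma completion_distxx f : completion_dist f f = 0.
Proof.
apply/le_anti/andP; split.
  by apply: completion_dist_le => j; rewrite subrr normr0.
by apply: le_trans (completion_dist_ub f f i0); rewrite subrr normr0.
Qed.

Lemma completion_positivity f g : completion_dist f g = 0 -> f = g.
Proof.
move=> fg0; apply: eq_sig_hprop => [h p q|]; first exact: Prop_irrelevance.
apply/funext => j; apply/eqP.
rewrite -subr_eq0 -normr_le0; apply: le_trans (completion_dist_ub f g j) _.
by rewrite fg0.
Qed.

Lemma completion_sym f g : completion_dist f g = completion_dist g f.
Proof.
by rewrite /completion_dist; congr sup; apply/eq_imagel => j _; exact: distrC.
Qed.

Lemma completion_triangle g f h :
  completion_dist f h <= completion_dist f g + completion_dist g h.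
Proof.
apply: completion_dist_le => j; apply: le_trans (ler_distD (sval g j) _ _) _.
by apply: lerD; exact: completion_dist_ub.
Qed.

Definition completion : metric_space R :=
  MetricSpace completion_distxx completion_positivity completion_sym
    completion_triangle.

Lemma completion_eval_le (f g : completion) j :
  `|sval f j - sval g j| <= mdist f g.
Proof. exact: completion_dist_ub. Qed.

Lemma completion_point_subproof i : forall e : R, 0 < e ->
  exists k, forall j, `|D i j - D k j| <= e.
Proof. by move=> e /ltW e0; exists i => j; rewrite subrr normr0. Qed.

Definition completion_point i : completion :=
  exist _ (D i) (completion_point_subproof i).

Lemma completion_pointE i j :
  mdist (completion_point i) (completion_point j) = D i j.
Proof.
apply/le_anti/andP; split.
  apply: completion_dist_le => k /=; have := Dtri j i k; have := Dtri i j k.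
  by rewrite (Dsym j i) ler_norml => *; apply/andP; split; lra.
have := completion_dist_ub (completion_point i) (completion_point j) j.
by rewrite /= Dxx subr0; apply: le_trans; exact: ler_norm.
Qed.

Lemma completion_dense (f : completion) (e : R) : 0 < e ->
  exists i, mdist f (completion_point i) <= e.
Proof.
by move=> /(proj2_sig f)[i fi]; exists i; apply: completion_dist_le.
Qed.

Lemma completion_complete : is_complete completion.
Proof.
move=> F FF /mdist_cauchyP cF.
have Fj j : cvg ((fun f : completion => sval f j) @ F).
  apply/cauchy_cvgP/cauchy_exP => e /cF[f Ff]; exists (sval f j).
  apply: (filterS _ Ff : F ((fun h :
    completion => sval h j) @^-1` _)) => g /= fg.
  exact: le_lt_trans (completion_eval_le f g j) fg.
pose l j := lim ((fun f : completion => sval f j) @ F).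
have lP (e : R) : 0 < e -> exists f : completion,
    F [set g | mdist f g < e] /\ forall j, `|sval f j - l j| <= e.
  move=> e0; have [f Ff] := cF _ e0; exists f; split => // j.
  have : (fun g : completion => `|sval f j - sval g j|) @ F --> `|sval f j - l
    j|.
    by apply: cvg_norm; apply: cvgB; [exact: cvg_cst|exact: Fj].
  move/cvgr_to_le; apply.
  apply: filterS Ff => g /ltW; apply: le_trans; exact: completion_eval_le.
have lc (e : R) : 0 < e -> exists i, forall j, `|l j - D i j| <= e.
  move=> e0; have e20 : 0 < e / 2 by rewrite divr_gt0.
  have [f [_ fl]] := lP _ e20; have [i fi] := proj2_sig f _ e20.
  exists i => j; rewrite (splitr e);
    apply: le_trans (ler_distD (sval f j) _ _) _.
  by rewrite distrC; apply: lerD.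
exists (exist _ l lc : completion).
apply/mdist_cvgP => e e0; have e30 : 0 < e / 3 by rewrite divr_gt0.
have [f [Ff fl]] := lP _ e30; apply: filterS Ff => g /= fg.
have lf : mdist f (exist _ l lc : completion) <= e / 3.
  exact: completion_dist_le.
have := metric_triangle (exist _ l lc : completion) f g.
by rewrite (metric_sym _ f); lra.
Qed.

End completion.

(** * Correspondences and the distance delta *)

Section correspondences.
Context {R : realType}.

(** Pointed correspondences of distortion at most [e], the classical substitute for embeddings into
    a common space. [C] may also relate points outside [A1] and [A2], which suits nets that overflow
    a ball. *)
Definition correspondence (X1 X2 : metric_space R) (A1 : set X1) (x1 : X1)
    (A2 : set X2) (x2 : X2) (e : R) (C : X1 -> X2 -> Prop) :=
  [/\ C x1 x2,
      forall x y x' y', C x y -> C x' y' ->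
        `|mdist x x' - mdist y y'| <= e,
      forall x, A1 x -> exists2 y, A2 y & C x y &
      forall y, A2 y -> exists2 x, A1 x & C x y].

(** * Gluing two spaces along a correspondence *)

Section gluing.
Variables (X1 X2 : metric_space R) (C : X1 -> X2 -> Prop) (e : R).
Hypothesis e0 : 0 < e.
Variables (x1 : X1) (x2 : X2).
Hypothesis Cx : C x1 x2.
Hypothesis Cdist : forall x y x' y', C x y -> C x' y' ->
  `|mdist x x' - mdist y y'| <= 2 * e.

Let through x y : set R :=
  [set t | exists u v, C u v /\ t = mdist x u + e + mdist v y].

(** A crossing costs half the distortion: two crossings then pay for the distortion in the triangle
    inequality, and distinct points stay at positive distance. *)
Definition glue_cross (x : X1) (y : X2) : R := inf (through x y).

Let through_lb x y : lbound (through x y) e.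
Proof.
move=> _ [u [v [_ ->]]]; have := mdist_ge0 x u; have := mdist_ge0 v y; lra.
Qed.

Let through_neq0 x y : through x y !=set0.
Proof. by exists (mdist x x1 + e + mdist x2 y), x1, x2. Qed.

Lemma glue_cross_le x y u v : C u v ->
  glue_cross x y <= mdist x u + e + mdist v y.
Proof. by move=> Cuv; apply: ge_inf; [exists e|exists u, v]. Qed.

Lemma glue_cross_ge x y (t : R) :
  (forall u v, C u v -> t <= mdist x u + e + mdist v y) -> t <= glue_cross x y.
Proof. by move=> tle; apply: lb_le_inf => // _ [u [v [Cuv ->]]];
  exact: tle. Qed.

Definition glue_dist (p q : X1 + X2) : R :=
  match p, q with
  | inl x, inl x' => mdist x x'
  | inr y, inr y' => mdist y y'
  | inl x, inr y | inr y, inl x => glue_cross x y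
  end.

Lemma glue_distxx p : glue_dist p p = 0.
Proof. by case: p => x; exact: mdistxx. Qed.

Lemma glue_cross_gt0 x y : 0 < glue_cross x y.
Proof. by apply: lt_le_trans e0 _; apply: lb_le_inf. Qed.

Lemma glue_positivity p q : glue_dist p q = 0 -> p = q.
Proof.
case: p q => [x|y] [x'|y'] /=.
- by move/mdist_positivity => ->.
- by have /lt0r_neq0/eqP := glue_cross_gt0 x y'.
- by have /lt0r_neq0/eqP := glue_cross_gt0 x' y.
- by move/mdist_positivity => ->.
Qed.

Lemma glue_sym p q : glue_dist p q = glue_dist q p.
Proof. by case: p q => [x|y] [x'|y'] //=; exact: metric_sym. Qed.

Lemma glue_triangle q p r : glue_dist p r <= glue_dist p q + glue_dist q r.
Proof.
have l2 (x x' : X1) y : mdist x x' <= glue_cross x y + glue_cross x' y.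
  rewrite -lerBlDr; apply: glue_cross_ge => u v Cuv.
  rewrite lerBlDr -lerBlDl; apply: glue_cross_ge => u' v' Cuv'.
  have := Cdist Cuv Cuv'; rewrite ler_norml => /andP[_].
  have := metric_triangle x u x'; have := metric_triangle u u' x'.
  have := metric_triangle v y v'.
  by rewrite (metric_sym u' x') (metric_sym y v'); lra.
have r2 (y y' : X2) x : mdist y y' <= glue_cross x y + glue_cross x y'.
  rewrite -lerBlDr; apply: glue_cross_ge => u v Cuv.
  rewrite lerBlDr -lerBlDl; apply: glue_cross_ge => u' v' Cuv'.
  have := Cdist Cuv Cuv'; rewrite ler_norml => /andP[+ _].
  have := metric_triangle y v y'; have := metric_triangle v v' y'.
  have := metric_triangle u x u'.
  by rewrite (metric_sym y v) (metric_sym u x); lra.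
have l1 (x x' : X1) y : glue_cross x y <= mdist x x' + glue_cross x' y.
  rewrite -lerBlDl; apply: glue_cross_ge => u v Cuv.
  by have := glue_cross_le x y Cuv; have := metric_triangle x x' u; lra.
have r1 (y y' : X2) x : glue_cross x y <= mdist y y' + glue_cross x y'.
  rewrite -lerBlDl; apply: glue_cross_ge => u v Cuv.
  have := glue_cross_le x y Cuv; have := metric_triangle v y' y.
  by rewrite (metric_sym y y'); lra.
case: p q r => [x|y] [x'|y'] [x''|y''] /=; try exact: metric_triangle.
- exact: l1.
- exact: l2.
- by rewrite addrC (metric_sym y' y''); exact: r1.
- by rewrite addrC metric_sym; exact: l1.
- exact: r2.
- exact: r1.
Qed.

Definition glue : metric_space R :=
  MetricSpace glue_distxx glue_positivity glue_sym glue_triangle.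

Lemma glue_hausdorff (A1 : set X1) (A2 : set X2) :
  (forall x, A1 x -> exists2 y, A2 y & C x y) ->
  (forall y, A2 y -> exists2 x, A1 x & C x y) ->
  hausdorff_dist ((inl : X1 -> glue) @` A1) ((inr : X2 -> glue) @` A2) <= e.
Proof.
move=> A12 A21.
have cross x y : C x y -> mdist (inl x : glue) (inr y) <= e.
  move=> Cxy; apply: le_trans (glue_cross_le x y Cxy) _.
  by rewrite !mdistxx add0r addr0.
apply: ge_inf; first by exists 0 => r [/ltW].
split => // [_ [x Ax <-]|_ [y Ay <-]].
  by have [y Ay Cxy] := A12 x Ax; exists (inr y); [exists y|exact: cross].
by have [x Ax Cxy] := A21 y Ay; exists (inl x); [exists x|exact: cross].
Qed.

End gluing.

Lemma delta_cpct_le (X1 X2 : metric_space R) (A1 : set X1) x1 (A2 : set X2) x2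
    (e : R) C : 0 < e -> correspondence A1 x1 A2 x2 (2 * e) C ->
  delta_cpct A1 x1 A2 x2 <= e.
Proof.
move=> e0 [Cx Cd C12 C21].
apply: (@le_trans _ _ (Num.max
    (hausdorff_dist ((inl : X1 -> glue e0 Cx Cd) @` A1)
                    ((inr : X2 -> glue e0 Cx Cd) @` A2))
    (mdist (inl x1 : glue e0 Cx Cd) (inr x2)))).
  apply: ge_inf.
    by exists 0 => r [E [f1 [f2 [_ _ ->]]]]; rewrite le_max mdist_ge0 orbT.
  by exists (glue e0 Cx Cd), inl, inr.
rewrite ge_max glue_hausdorff//=.
apply: le_trans (glue_cross_le e x1 x2 Cx) _.
by rewrite !mdistxx add0r addr0.
Qed.

Section delta_cpct_bounded.
Variables (X1 X2 : metric_space R) (A1 : set X1) (x1 : X1).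
Variables (A2 : set X2) (x2 : X2) (k : R).
Hypotheses (k0 : 0 < k) (Ax1 : A1 x1) (Ax2 : A2 x2).
Hypothesis A1k : forall x, A1 x -> mdist x1 x <= k.
Hypothesis A2k : forall y, A2 y -> mdist x2 y <= k.

Lemma delta_cpct_ge0 : 0 <= delta_cpct A1 x1 A2 x2.
Proof.
rewrite /delta_cpct; set S := [set r | _].
have [->|S0] := eqVneq S set0; first by rewrite inf0.
apply: lb_le_inf; first exact/set0P.
by move=> r [E [f1 [f2 [_ _ ->]]]]; rewrite le_max mdist_ge0 orbT.
Qed.

(** In balls of radius [k] all distances lie in [0, 2 k]. Besides bounding [delta_cpct], this shows
    that its infimum is over a nonempty set, and is not the default value of [inf]. *)
Lemma full_correspondence :
  correspondence A1 x1 A2 x2 (2 * k) (fun x y => A1 x /\ A2 y).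
Proof.
split => // [x y x' y' [Ax Ay] [Ax' Ay']|x Ax|y Ay]; last 2 first.
- by exists x2.
- by exists x1.
have := metric_triangle x x1 x'; have := metric_triangle y x2 y'.
have := A1k Ax; have := A1k Ax'; have := A2k Ay; have := A2k Ay'.
have := mdist_ge0 x x'; have := mdist_ge0 y y'.
rewrite (metric_sym x x1) (metric_sym y x2) ler_norml => *.
by apply/andP; split; lra.
Qed.

Lemma delta_cpct_le_radius : delta_cpct A1 x1 A2 x2 <= k.
Proof. exact: delta_cpct_le full_correspondence. Qed.

Lemma delta_cpct_lt (e : R) : delta_cpct A1 x1 A2 x2 < e ->
  exists C, correspondence A1 x1 A2 x2 (2 * e) C.
Proof.
rewrite /delta_cpct; set S := [set r | _] => Se.
have S0 : S !=set0.
  have [Cx Cd _ _] := full_correspondence.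
  exists (Num.max
    (hausdorff_dist ((inl : X1 -> glue k0 Cx Cd) @` A1)
                    ((inr : X2 -> glue k0 Cx Cd) @` A2))
    (mdist (inl x1 : glue k0 Cx Cd) (inr x2))).
  by exists (glue k0 Cx Cd), inl, inr.
have [r [E [f1 [f2 [f1i f2i ->]]]]] := inf_lt S0 Se.
rewrite gt_max => /andP[hd rd].
have d1 x x' : A1 x -> A1 x' -> mdist (f1 x) (f1 x') = mdist x x'.
  by move=> *; apply: f1i; rewrite inE.
have d2 y y' : A2 y -> A2 y' -> mdist (f2 y) (f2 y') = mdist y y'.
  by move=> *; apply: f2i; rewrite inE.
(* The set of admissible radii has to be inhabited: on an empty set [inf] would return 0 and [hd]
   would carry no information. The base points provide a radius. *)
have [|t [t0 t12 t21] te] := inf_lt _ hd.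
  exists (2 * k + e); split.
  - by have := mdist_ge0 (f1 x1) (f2 x2); have := k0; lra.
  - move=> _ [x Ax <-]; exists (f2 x2); first by exists x2.
    have := metric_triangle (f1 x) (f1 x1) (f2 x2).
    by rewrite d1// (metric_sym x x1); have := A1k Ax; have := k0; lra.
  - move=> _ [y Ay <-]; exists (f1 x1); first by exists x1.
    have := metric_triangle (f1 x1) (f2 x2) (f2 y).
    by rewrite d2//; have := A2k Ay; have := k0; lra.
exists (fun x y => [/\ A1 x, A2 y & mdist (f1 x) (f2 y) <= e]).
split.
- by split => //; exact: ltW.
- move=> x y x' y' [Ax Ay xy] [Ax' Ay' xy'].
  have := metric_triangle (f1 x) (f2 y) (f1 x').
  have := metric_triangle (f2 y) (f2 y') (f1 x').
  have := metric_triangle (f2 y) (f1 x) (f2 y').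
  have := metric_triangle (f1 x) (f1 x') (f2 y').
  rewrite d1// d2// (metric_sym (f2 y') (f1 x')) (metric_sym (f2 y) (f1 x)).
  by rewrite ler_norml => *; apply/andP; split; lra.
- move=> x Ax; have [|_ [y Ay <-] xy] := t12 (f1 x); first by exists x.
  by exists y => //; split => //; exact: le_trans (ltW te).
- move=> y Ay; have [|_ [x Ax <-] xy] := t21 (f2 y); first by exists y.
  by exists x => //; split => //; exact: le_trans (ltW te).
Qed.

End delta_cpct_bounded.

(** * Truncating the series that defines delta *)

Section tree_delta.
Variables T1 T2 : clcr_tree R.

Definition ball_delta (k : nat) : R :=
  delta_cpct (root_ball T1 k%:R) (tree_root T1)
             (root_ball T2 k%:R) (tree_root T2).

Definition ball_correspondence (k : nat) (e : R) C :=
  correspondence (root_ball T1 k%:R) (tree_root T1)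
             (root_ball T2 k%:R) (tree_root T2) e C.

Lemma root_ball_root (T : clcr_tree R) (k : nat) :
  root_ball T k%:R (tree_root T).
Proof. by rewrite /root_ball/= mdistxx. Qed.

Lemma ball_delta_ge0 k : 0 <= ball_delta k.
Proof. exact: delta_cpct_ge0. Qed.

Lemma ball_delta_le k : (0 < k)%N -> ball_delta k <= k%:R.
Proof.
by move=> k0; apply: delta_cpct_le_radius; rewrite ?ltr0n//;
  exact: root_ball_root.
Qed.

Definition delta_term (k : nat) : R := 2 ^- k * ball_delta k.
Definition delta_partial (n : nat) : R := \sum_(1 <= k < n) delta_term k.

Let term_ge0 k : 0 <= delta_term k.
Proof. by rewrite mulr_ge0 ?ball_delta_ge0// invr_ge0 exprn_ge0. Qed.

Let partial_cat m n : (1 <= m)%N -> (m <= n)%N ->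
  delta_partial n = delta_partial m + \sum_(m <= k < n) delta_term k.
Proof. by move=> m1 mn; rewrite /delta_partial (big_cat_nat m1 mn). Qed.

(* sum_(m <= k < n) k / 2^k telescopes, with 2 (k + 1) / 2^k as primitive. *)
Lemma tail_le m n : (1 <= m)%N -> (m <= n)%N ->
  \sum_(m <= k < n) delta_term k <= 2 * m.+1%:R * 2 ^- m.
Proof.
move=> m1 mn; suff : \sum_(m <= k < n) delta_term k <=
    2 * m.+1%:R * 2 ^- m - 2 * n.+1%:R * 2 ^- n.
  move/le_trans; apply; rewrite lerBlDr lerDl.
  by rewrite !mulr_ge0// invr_ge0 exprn_ge0.
elim: n mn => [|n ih]; first by rewrite leqNgt m1.
rewrite leq_eqVlt => /predU1P[<-|]; first by rewrite big_geq// subrr.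
rewrite ltnS => mn; rewrite big_nat_recr//=.
have n0 : (0 < n)%N by exact: leq_trans mn.
have tn : delta_term n <= 2 ^- n * n%:R.
  by rewrite ler_wpM2l ?ball_delta_le// invr_ge0 exprn_ge0.
apply: le_trans (lerD (ih mn) tn) _.
have -> : 2 ^- n.+1 = 2 ^- n / 2 :> R by rewrite exprSr invfM.
by rewrite -(natr1 n.+1) -(natr1 n); lra.
Qed.

Let partial_nd : nondecreasing_seq delta_partial.
Proof.
move=> m n mn; case: m mn => [|m] mn.
  by rewrite /delta_partial big_geq// sumr_ge0.
by rewrite (partial_cat _ mn)// lerDl sumr_ge0.
Qed.

Let partial_le n : (1 <= n)%N -> delta_partial n <= 2.
Proof.
move=> n1; apply: le_trans (tail_le (leqnn 1) n1) _.
by rewrite expr1; lra.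
Qed.

Let partial_cvg : cvgn delta_partial.
Proof.
apply: nondecreasing_is_cvgn => //; exists 2 => _ [n _ <-].
by case: n => [|n]; [rewrite /delta_partial big_geq|exact: partial_le].
Qed.

Lemma ball_delta_le_tree_delta k : (1 <= k)%N ->
  2 ^- k * ball_delta k <= tree_delta T1 T2.
Proof.
move=> k1; apply: le_trans (nondecreasing_cvgn_le partial_nd partial_cvg k.+1).
by rewrite /delta_partial big_nat_recr//= lerDr sumr_ge0.
Qed.

Lemma tree_delta_le m : (1 <= m)%N ->
  tree_delta T1 T2 <= delta_partial m + 2 * m.+1%:R * 2 ^- m.
Proof.
move=> m1; apply: limr_le => //.
exists m => // n /= mn;
  change (delta_partial n <= delta_partial m + 2 * m.+1%:R * 2 ^- m).
by rewrite (partial_cat m1 mn) lerD2l; exact: tail_le.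
Qed.

Lemma partial_le_uniform m (e : R) : 0 <= e ->
  (forall k, (1 <= k < m)%N -> ball_delta k <= e) -> delta_partial m <= e.
Proof.
move=> e0 de.
(* The factor 1 - 2 / 2^n is the exact sum of 2^-k over 1 <= k < n; keeping it makes the induction
   close. *)
suff : forall n, (n <= m)%N -> (1 <= n)%N ->
  delta_partial n <= e * (1 - 2 * 2 ^- n).
  case: m de => [|m] de h; first by rewrite /delta_partial big_geq.
  apply: le_trans (h _ (leqnn _) isT) _.
  by rewrite ler_piMr// lerBlDr lerDl mulr_ge0// invr_ge0 exprn_ge0.
elim=> [//|[|n] ih] nm _.
  by rewrite /delta_partial big_geq// expr1 divff// subrr mulr0.
rewrite /delta_partial big_nat_recr//=.
have := ih (ltnW nm) isT; rewrite /delta_partial.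
have : delta_term n.+1 <= 2 ^- n.+1 * e.
  by rewrite ler_wpM2l ?de// invr_ge0 exprn_ge0.
have -> : 2 ^- n.+2 = 2 ^- n.+1 / 2 :> R by rewrite exprSr invfM.
lra.
Qed.

End tree_delta.
Arguments ball_correspondence : clear implicits.
Arguments delta_partial : clear implicits.

Lemma tree_delta_lt_correspondence (k : nat) (e : R) : (1 <= k)%N -> 0 < e ->
  exists2 eta : R, 0 < eta & forall T1 T2 : clcr_tree R,
    tree_delta T1 T2 < eta -> exists C, ball_correspondence T1 T2 k e C.
Proof.
move=> k1 e0; exists (2 ^- k * (e / 2)).
  by rewrite mulr_gt0// ?divr_gt0// invr_gt0 exprn_gt0.
move=> T1 T2 Te.
have : 2 ^- k * ball_delta T1 T2 k < 2 ^- k * (e / 2).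
  by apply: le_lt_trans Te; exact: ball_delta_le_tree_delta.
rewrite ltr_pM2l ?invr_gt0 ?exprn_gt0// /ball_delta => Tk.
have [|||||C] := delta_cpct_lt (k := k%:R) _ _ _ _ _ Tk; rewrite ?ltr0n//.
- exact: root_ball_root.
- exact: root_ball_root.
by rewrite mulrC divfK// => CC; exists C.
Qed.

Lemma tree_delta_lt_of_correspondence (eta : R) : 0 < eta ->
  exists m (e : R), 0 < e /\ forall T1 T2 : clcr_tree R,
    (forall k, (1 <= k < m)%N -> exists C, ball_correspondence T1 T2 k e C) ->
    tree_delta T1 T2 < eta.
Proof.
move=> eta0.
(* With truncation at m = 2 p, the tail bound 2 (2 p + 1) / 4^p is at most 4 / (p + 1), since (p +
   1)^2 <= 4^p. *)
have [p p0 peta] : exists2 p, (1 <= p)%N & 4 / p.+1%:R < eta / 2 :> R.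
  exists (Num.bound (8 / eta)).+1 => //.
  set p := (Num.bound (8 / eta)).+1;
    have := archi_boundP (ltW (divr_gt0 (ltr0n R 8) eta0)).
  move=> /lt_le_trans/(_ (_ : _ <= p.+1%:R)); rewrite ler_nat ltr_pdivrMr//.
  by move=> /(_ (leqW (leqnSn _))) pe; rewrite ltr_pdivrMr ?ltr0n//; lra.
exists (2 * p)%N, eta; split => // T1 T2 TC.
have m1 : (1 <= 2 * p)%N by rewrite muln_gt0.
apply: le_lt_trans (tree_delta_le T1 T2 m1) _.
rewrite (splitr eta) ler_ltD//.
  apply: partial_le_uniform => [|k /TC[C CC]]; first by rewrite divr_ge0// ltW.
  apply: (@delta_cpct_le _ _ _ _ _ _ _ C); first by rewrite divr_gt0.
  by rewrite mulrC divfK.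
apply: le_lt_trans peta.
have pp : p.+1%:R <= 2 ^+ p :> R by rewrite -natrX ler_nat ltn_expl.
have p10 : 0 < p.+1%:R :> R by rewrite ltr0n.
have p2 : p.+1%:R * p.+1%:R <= 2 ^+ p * 2 ^+ p :> R.
  by apply: ler_pM => //; rewrite ltW.
rewrite ler_pdivrMr ?exprn_gt0// mulrAC ler_pdivlMr// mulnC exprM expr2.
have -> : (p * 2).+1%:R = 2 * p.+1%:R - 1 :> R.
  by rewrite -(natr1 (p * 2)) natrM -(natr1 p); lra.
lra.
Qed.

End correspondences.
Arguments ball_correspondence {R} T1 T2 k e C.
Arguments delta_partial {R} T1 T2 n.

(** * Level counts of a tree *)

Lemma ultra_fmap (U V : Type) (f : U -> V) (F : set_system U) :
  UltraFilter F -> UltraFilter (f @ F).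
Proof.
move=> UF; split=> [|G PG FG]; first exact: fmap_proper_filter.
apply/seteqP; split => // A GA.
have [//|nA] := in_ultra_setVsetC (f @^-1` A) UF.
have /FG GnA : (f @ F) (~` A) by [].
by have [x []] := filter_ex (filterI GA GnA).
Qed.

Lemma fset_injection (U : choiceType) (x0 : U) (X : {fset U}) n :
  (n <= #|` X|)%N -> exists2 x : 'I_n -> U, injective x & forall i, x i \in X.
Proof.
move=> nX; exists (fun i => nth x0 X i) => [i j /eqP|i].
  rewrite nth_uniq ?fset_uniq ?(leq_trans (ltn_ord _) nX)// => /eqP.
  exact: val_inj.
by rewrite mem_nth// (leq_trans (ltn_ord i) nX).
Qed.

Lemma fset_injection_card (U : choiceType) (X : {fset U}) n (x : 'I_n -> U) :
  injective x -> (forall i, x i \in X) -> (n <= #|` X|)%N.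
Proof.
move=> xi xX; rewrite -[n in (n <= _)%N]size_enum_ord -(size_map x).
apply: uniq_leq_size; first by rewrite map_inj_uniq ?enum_uniq.
by move=> _ /mapP[i _ ->].
Qed.

Lemma totally_bounded_packing (R : realType) (T : metricType R) (A : set T)
    (r : R) : totally_bounded A -> 0 < r -> exists N, forall n (y : 'I_n -> T),
  (forall i, A (y i)) -> (forall i j, i != j -> r <= mdist (y i) (y j)) ->
  (n <= N)%N.
Proof.
move=> tA r0; have [s sA] := tA (r / 2) ltac:(by rewrite divr_gt0).
exists (size s) => n y yA yr.
have /choice[f fP] : forall i, exists z, z \in s /\ mdist z (y i) < r / 2.
  by move=> i; have [z zs zy] := sA _ (yA i); exists z.
have fi : injective f.
  move=> i j fij; apply/eqP; apply: contrapT => /negP/yr.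
  have [_ fyi] := fP i; have [_] := fP j; rewrite -fij => fyj.
  by have := metric_triangle (y i) (f i) (y j);
    rewrite (metric_sym (y i) (f i)); lra.
rewrite -[n in (n <= _)%N]size_enum_ord -(size_map f).
apply: uniq_leq_size; first by rewrite map_inj_uniq ?enum_uniq.
by move=> _ /mapP[i _ ->]; case: (fP i).
Qed.

(** * Families of points that witness level counts *)

Section spread.
Context {R : realType} (T : clcr_tree R).
Implicit Types (x y z : T) (b c h a : R).

Definition height x := mdist (tree_root T) x.

Let T4 : four_point T := real_tree_four_point (@clcr_real_tree R T).
Let Ti : interpolable T := real_tree_interpolable (@clcr_real_tree R T).

Lemma tree_ball_totally_bounded c : totally_bounded [set x | height x <= c].
Proof.
exact: totally_bounded_mball (@clcr_complete R T) (@clcr_locally_compact R T)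
  Ti _ _.
Qed.

Lemma tree_ball_compact c : compact [set x | height x <= c].
Proof.
apply: totally_bounded_compact (@clcr_complete R T) _ _.
  exact: closed_mball.
exact: tree_ball_totally_bounded.
Qed.

(** [z] is the ancestor of [y] cut at height [c]; being an ancestor is encoded by an equality of
    distances. *)
Lemma truncation y c : 0 <= c -> exists z,
  height z = Num.min (height y) c /\ mdist z y = height y - height z.
Proof.
move=> c0; have [yc|cy] := leP (height y) c.
  by exists y; rewrite subrr mdistxx.
have [|z [zc zy]] := Ti (x := tree_root T) (y := y) (s := c).
  by rewrite c0 ltW.
by exists z; rewrite /height zc.
Qed.

Lemma gprod_truncation y z w : mdist z y = height y - height z ->
  gprod (tree_root T) z w <= gprod (tree_root T) y w.
Proof.
by rewrite /gprod -!/(height _) => zy; have := metric_triangle y z w;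
  rewrite (metric_sym y z); lra.
Qed.

(** Witnesses that n distinct subtrees above level [b] reach height [c]. Unlike the points of the
    erased tree, they are described by inequalities between finitely many distances. *)
Definition spread n b c :=
  exists y : 'I_n -> T, (forall i, c <= height (y i)) /\
  forall i j, i != j -> gprod (tree_root T) (y i) (y j) < 2 * b.

(** The strict version, which is an open condition on the tree. *)
Definition open_spread n b c := exists y : 'I_n -> T,
  (forall i, c < height (y i)) /\
  forall i j, i != j -> gprod (tree_root T) (y i) (y j) < 2 * b.

Lemma spread_monotone n b b' c c' : b <= b' -> c' <= c ->
  spread n b c -> spread n b' c'.
Proof.
move=> bb cc [y [yc yb]]; exists y; split => [i|i j /yb]; last lra.
exact: le_trans cc (yc i).
Qed.

Lemma open_spreadW n b c : open_spread n b c -> spread n b c.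
Proof. by move=> [y [yc yb]]; exists y; split => // i; exact/ltW. Qed.

Lemma spread_truncated n b c : 0 <= c -> spread n b c ->
  exists y : 'I_n -> T, (forall i, height (y i) = c) /\
    forall i j, i != j -> gprod (tree_root T) (y i) (y j) < 2 * b.
Proof.
move=> c0 [y [yc yb]].
have /choice[z zP] i := truncation (y i) c0.
exists z; split => [i|i j /yb]; first by rewrite (zP i).1 min_r.
have := gprod_truncation (z j) (zP i).2;
  have := gprod_truncation (y i) (zP j).2.
by rewrite (gprodC _ (z j)) (gprodC _ (y j)); lra.
Qed.

(** Cut at the common height [c], points that branch below [b] are more than 2 (c - b) apart, in a
    totally bounded ball. *)
Lemma spread_bounded b c : 0 <= c -> b < c ->
  exists N, forall n, spread n b c -> (n <= N)%N.
Proof.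
move=> c0 bc.
have [|N NP] := @totally_bounded_packing _ _ _ (2 * (c - b))
  (@tree_ball_totally_bounded c); first by lra.
exists N => n /(spread_truncated c0)[y [yc yb]].
apply: (NP _ y) => [i|i j /yb]; first by rewrite /= yc.
by rewrite /gprod -!/(height _) !yc; lra.
Qed.

(** A point of level [a] is exchanged with a descendant at least [h] above it. Distinctness at level
    [a] corresponds to branching below [a] by the ultrametric inequality for Gromov products. *)
Lemma tree_level_countP h a n : 0 < h -> 0 < a ->
  (n <= tree_level_count h a T)%N <-> spread n a (a + h).
Proof.
move=> h0 a0; rewrite /tree_level_count -/height; set L := _ `&` _.
have LP x : L x <-> height x = a /\
    exists y, height x + mdist x y = height y /\ h <= mdist x y.
  split=> [[[->|[y [/(segmentP T4 Ti) xy hy]]] xa]|[xa [y [xy hy]]]].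
  - by move: xa a0; rewrite /= /height mdistxx => <-; rewrite ltxx.
  - by split => //; exists y.
  - by split => //; right; exists y; split => //; apply/(segmentP T4 Ti).
have Lspread m (x : 'I_m -> T) : injective x -> (forall i, L (x i)) ->
    spread m a (a + h).
  move=> xi xL.
  have /choice[y yP] i : exists y, height (x i) + mdist (x i) y = height y /\
      h <= mdist (x i) y by have /LP[] := xL i.
  have xa i : height (x i) = a by have /LP[] := xL i.
  exists y; split => [i|i j ij].
    by have [<- hy] := yP i; rewrite xa lerD2l.
  rewrite ltNge; apply: contra_neqN ij => yij; apply: xi; apply: mdist_eq0.
  have xy k : 2 * a <= gprod (tree_root T) (x k) (y k).
    by rewrite /gprod -!/(height _); have := xa k; have [] := yP k; lra.
  have := gprod_ultra T4 (gprod_ultra T4 (xy i) yij) (y := y j) (z := x j).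
  rewrite gprodC => /(_ (xy j)).
  by rewrite /gprod -!/(height _) !xa metric_sym; lra.
(* Finiteness matters: on an infinite level [fset_set] would give the count 0. *)
have Lfin : finite_set L.
  apply: contrapT => Linf; have [||N NP] := @spread_bounded a (a + h);
    [lra|lra|].
  have [X XL NX] := infinite_set_fset N.+1 Linf.
  have [x xi xX] := fset_injection (tree_root T) NX.
  by have := NP _ (Lspread _ x xi (fun i => XL _ (xX i))); rewrite ltnn.
split=> [nL|[y [ya yb]]].
  have [x xi xX] := fset_injection (tree_root T) nL.
  by apply: (Lspread n x) => // i; have := xX i; rewrite in_fset_set// inE.
have /choice[x xP] i : exists x, height x = a /\
  height x + mdist x (y i) = height (y i).
  have [|x [xa xy]] := Ti (x := tree_root T) (y := y i) (s := a).
    by have := ya i; rewrite /height; lra.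
  by exists x; split => //; rewrite /height xa xy -/(height _); lra.
apply: (fset_injection_card (x := x)) => [i j xij|i]; last first.
  rewrite in_fset_set// inE; apply/LP; have [xa xy] := xP i; split => //.
  by exists (y i); split => //; have := ya i; lra.
apply/eqP; apply: contrapT => /negP/yb.
have xy k : 2 * a <= gprod (tree_root T) (x k) (y k).
  by rewrite /gprod -!/(height _); have := xP k; lra.
have yx : 2 * a <= gprod (tree_root T) (y i) (x j).
  by rewrite gprodC -xij; exact: xy.
by have := gprod_ultra T4 yx (xy j); lra.
Qed.

(* Level b is approached from below as finitely many branch points matter, and
   height c by compactness of the balls; the conditions on the right-hand side
   are open in the tree. *)
Lemma spread_countable n b c : 0 <= c -> spread n b c <->
  exists k : nat, forall m : nat,
    open_spread n (b - k.+1%:R^-1) (c - m.+1%:R^-1).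
Proof.
move=> c0; split=> [[y [yc yb]]|[k km]].
  have [|e e0 eP] := @finite_pos_lower_bound R ('I_n * 'I_n)%type
    (enum {: 'I_n * 'I_n})
    (fun p => if p.1 != p.2 then 2 * b - gprod (tree_root T) (y p.1) (y p.2)
              else 1).
    by move=> [i j] _ /=; case: ifP => // /yb; lra.
  have [k _ /(_ k (leqnn k))/= ke] :=
    near_infty_natSinv_lt (PosNum (divr_gt0 e0 (ltr0n R 2))).
  rewrite /= in ke.
  exists k => m; exists y; split => [i|i j ij].
    have m0 : 0 < m.+1%:R^-1 :> R by rewrite invr_gt0 ltr0n.
    by rewrite ltrBlDr (le_lt_trans (yc i))// ltrDl.
  have := eP (i, j); rewrite mem_enum /= ij => /(_ isT) e_le.
  set q := k.+1%:R^-1 in ke *; lra.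
have : 0 < k.+1%:R^-1 :> R by rewrite invr_gt0 ltr0n.
set q := k.+1%:R^-1 in km * => q0.
have /choice[y yP] m : exists y : 'I_n -> T,
    (forall i, c - m.+1%:R^-1 <= height (y i) <= c) /\
    forall i j, i != j -> gprod (tree_root T) (y i) (y j) < 2 * (b - q).
  have [y [yc yb]] := km m.
  have /choice[z zP] i := truncation (y i) c0.
  have m0 : 0 < m.+1%:R^-1 :> R by rewrite invr_gt0 ltr0n.
  exists z; split => [i|i j /yb].
    rewrite (zP i).1 le_min ge_min lexx orbT andbT (ltW (yc i))/=.
    by rewrite lerBlDr lerDl ltW.
  have := gprod_truncation (z j) (zP i).2;
    have := gprod_truncation (y i) (zP j).2.
  by rewrite (gprodC _ (z j)) (gprodC _ (y j)); lra.
(* A single ultrafilter on the indices [m] makes all n sequences of points converge at once. *)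
have [G [UG NG]] := ultraFilterLemma eventually_filter.
have /choice[l lP] : forall i : 'I_n, exists l : T, (fun m => y m i) @ G --> l.
  move=> i.
  have := @tree_ball_compact c;
    rewrite compact_ultra => /(_ _ (ultra_fmap (fun m => y m i) UG)).
  case.
    by apply: NG; exists 0%N => // m _ /=; have /andP[] := (yP m).1 i.
  by move=> l [_ /= lG]; exists l.
have close (e : R) : 0 < e -> exists m, forall i,
    mdist (l i) (y m i) < e /\ c - e < height (y m i).
  move=> e0.
  have /filter_forall/filterI/(_ (NG _ (near_infty_natSinv_lt (PosNum e0)))) :
      forall i, G [set m | mdist (l i) (y m i) < e].
    by move=> i; have /mdist_cvgP/(_ e e0) := lP i.
  move=> /filter_ex[m [lm /= me]]; exists m => i; split; first exact: lm.
  have /andP[+ _] := (yP m).1 i; apply: lt_le_trans.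
  by rewrite ltrD2l ltrN2.
exists l; split => [i|i j ij].
  apply/ler_addgt0Pl => e e0; have [|m lm] := close (e / 2); first lra.
  have := metric_triangle (tree_root T) (l i) (y m i); rewrite -!/(height _).
  by have := lm i; lra.
suff : gprod (tree_root T) (l i) (l j) <= 2 * (b - q) by lra.
apply/ler_addgt0Pl => e e0; have [|m lm] := close (e / 4); first lra.
have := lm i; have := lm j; have := (yP m).2 _ _ ij; rewrite /gprod.
have := metric_triangle (tree_root T) (y m i) (l i).
have := metric_triangle (tree_root T) (y m j) (l j).
have := metric_triangle (y m i) (l i) (y m j).
have := metric_triangle (l i) (l j) (y m j).
by rewrite (metric_sym (y m i) (l i)) (metric_sym (y m j) (l j)); lra.
Qed.

(* c1 exists because finitely many subtrees above level b exceed height c0. *)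
Lemma spread_gap b c0 : 0 <= b -> b < c0 -> exists2 c1, c0 < c1 &
  forall y, c0 < height y -> exists2 y', c1 <= height y' &
    2 * b <= gprod (tree_root T) y y'.
Proof.
move=> b0 bc.
have [|N NP] := @spread_bounded b c0 _ bc; first exact/ltW/(le_lt_trans b0).
pose P n := `[< open_spread n b c0 >].
have P0 : exists n, P n.
  by exists 0%N; apply/asboolP; exists (fun=> tree_root T); split => -[].
have PN n : P n -> (n <= N)%N by move/asboolP/open_spreadW; exact: NP.
have [n /asboolP[y [yc yb]] nmax] := ex_maxnP P0 PN.
have [|e e0 eP] := @finite_pos_lower_bound R 'I_n (enum 'I_n)
    (fun i => height (y i) - c0).
  by move=> i _; rewrite subr_gt0.
exists (c0 + e) => [|z zc]; first by rewrite ltrDl.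
apply: contrapT => nz.
have zb i : gprod (tree_root T) z (y i) < 2 * b.
  rewrite ltNge; apply/negP => zy; apply: nz; exists (y i) => //.
  by have := eP i; rewrite mem_enum => /(_ isT); lra.
suff /nmax : P n.+1 by rewrite ltnn.
apply/asboolP.
exists (fun i : 'I_n.+1 => if unlift ord0 i is Some j then y j else z).
split=> [i|i j]; first by case: unliftP.
case: unliftP => [i' ->|->]; case: unliftP => [j' ->|->].
- by rewrite (inj_eq lift_inj) => /yb.
- by move=> _; rewrite gprodC.
- by move=> _; exact: zb.
- by rewrite eqxx.
Qed.

(** By [spread_gap], for [b] slightly above [a] the moving height b + h may be replaced by the fixed
    height [c1]. The condition is then monotone in [b], hence eventually constant as [b] decreases
    to [a]. *)
Lemma spread_right_limit n a h : 0 <= a -> 0 < h ->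
  (\forall b \near a^'+, spread n b (b + h)) \/
  (\forall b \near a^'+, ~ spread n b (b + h)).
Proof.
move=> a0 h0.
have [||c1 ac cP] := @spread_gap (a + h / 2) (a + h); [lra|lra|].
have key b : a < b -> b < a + h / 2 -> b + h <= c1 ->
    spread n b (b + h) <-> spread n b c1.
  move=> ab bh bc; split; last exact: spread_monotone.
  move=> [y [yc yb]].
  have /choice[z zP] i : exists z, c1 <= height z /\
      2 * (a + h / 2) <= gprod (tree_root T) (y i) z.
    by have [|z] := cP (y i); [have := yc i; lra|exists z].
  exists z; split => [i|i j ij]; first by case: (zP i).
  rewrite ltNge; apply/negP => zij.
  have yz k : 2 * b <= gprod (tree_root T) (y k) (z k).
    by have [_] := zP k; lra.
  have zy : 2 * b <= gprod (tree_root T) (z j) (y j) by rewrite gprodC.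
  by have := gprod_ultra T4 (gprod_ultra T4 (yz i) zij) zy; have := yb _ _ ij;
    lra.
pose m := Num.min (a + h / 2) (c1 - h).
have am : a < m by rewrite /m lt_min; apply/andP; split; lra.
have near_lt d : a < d -> \forall b \near a^'+, a < b /\ b < d.
  move=> ad; near=> b; split; near: b; first exact: nbhs_right_gt.
  exact: nbhs_right_lt.
have [[b [ab bm nb]]|nex] := pselect (exists b, [/\ a < b, b < m &
    ~ spread n b (b + h)]).
  right; apply: filterS (near_lt b ab) => b' [ab' b'b].
  move: bm; rewrite /m lt_min => /andP[bm1 bm2].
  have [||k1 _] := key b' ab'; [lra|lra|].
  move=> /k1/(spread_monotone (ltW b'b) (lexx _)).
  by have [||_ k2 /k2//] := key b ab; lra.
left; apply: filterS (near_lt m am) => b [ab bm].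
by apply: contrapT => nb; apply: nex; exists b.
Unshelve. all: by end_near.
Qed.

End spread.

(** * Measurability of the level counts *)

Lemma finite_upper_bound (R : realType) n (f : 'I_n -> R) :
  exists2 k : nat, (1 <= k)%N & forall i, f i <= k%:R.
Proof.
exists (\max_(i < n) Num.bound `|f i|).+1 => // i.
apply: le_trans (ler_norm _) _; apply: ltW.
apply: lt_le_trans (archi_boundP (normr_ge0 (f i))) _.
by rewrite ler_nat; apply: leqW; exact: (leq_bigmax i).
Qed.

(** * Open conditions on trees *)

Section open_sets.
Context {R : realType}.
Implicit Types (t u : trees R).

Lemma ball_correspondence_height (T1 T2 : clcr_tree R) k (e : R) C x y :
  ball_correspondence T1 T2 k e C -> C x y -> `|height x - height y| <= e.
Proof. by move=> [Cr Cd _ _] Cxy; exact: Cd. Qed.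

(** The common source of openness: a finite family lies in some ball of integer radius, and a
    correspondence on that ball carries it to every nearby tree. *)
Lemma delta_transport t n (y : 'I_n -> tree_repr t) (e : R) : 0 < e ->
  exists2 eta : R, 0 < eta & forall u, delta t u < eta ->
    exists z : 'I_n -> tree_repr u,
      (forall i, `|height (y i) - height (z i)| <= e) /\
      (forall i j, `|mdist (y i) (y j) - mdist (z i) (z j)| <= e).
Proof.
move=> e0; have [k k1 ky] := finite_upper_bound (fun i => height (y i)).
have [eta eta0 etaP] := @tree_delta_lt_correspondence R k e k1 e0.
exists eta => // u /etaP[C CC]; have [_ Cd C12 _] := CC.
have /choice[z zP] i : exists z, C (y i) z.
  by have [z _ Cz] := C12 _ (ky i); exists z.
exists z; split => [i|i j]; last exact: Cd.
exact: ball_correspondence_height CC (zP i).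
Qed.

Lemma open_open_spread n (b c : R) :
  open [set t : trees R | open_spread (tree_repr t) n b c].
Proof.
move=> t /= [y [yc yb]].
have [|e1 e10 e1P] := @finite_pos_lower_bound R 'I_n (enum 'I_n)
    (fun i => height (y i) - c).
  by move=> i _; rewrite subr_gt0.
have [|e2 e20 e2P] := @finite_pos_lower_bound R ('I_n * 'I_n)%type
    (enum {: 'I_n * 'I_n})
    (fun p => if p.1 != p.2
              then 2 * b - gprod (tree_root _) (y p.1) (y p.2) else 1).
  by move=> [i j] _ /=; case: ifP => // /yb; lra.
(* A Gromov product involves three distances, whose errors add up to 3 e < e2. *)
pose e := Num.min e1 e2 / 4.
have [m1 m2] : Num.min e1 e2 <= e1 /\ Num.min e1 e2 <= e2.
  by rewrite !ge_min !lexx orbT.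
have e0 : 0 < e by rewrite divr_gt0// lt_min e10.
have [eta eta0 etaP] := delta_transport y e0.
exists eta => // u /etaP[z [zh zd]]; exists z; split => [i|i j ij].
  have := e1P i; rewrite mem_enum => /(_ isT).
  by have := zh i; rewrite ler_norml /e in e0 * => /andP[_]; lra.
have := e2P (i, j); rewrite mem_enum /= ij => /(_ isT).
have := zh i; have := zh j; have := zd i j.
rewrite !ler_norml /gprod -!/(height _) => /andP[z1 z2] /andP[z3 z4]
  /andP[z5 z6].
by rewrite /e in e0 z1 z2 z3 z4 z5 z6; lra.
Qed.

(** Strict inequalities make the existence of such a family an open condition, and its failure a
    closed one. *)
Definition packing (T : clcr_tree R) n (s r : R) := exists y : 'I_n -> T,
  (forall i, height (y i) < s) /\ forall i j, i != j -> r < mdist (y i) (y j).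

Lemma packing_monotone (T : clcr_tree R) n (s s' r r' : R) : s <= s' ->
  r' <= r ->
  packing T n s r -> packing T n s' r'.
Proof.
move=> ss rr [y [ys yr]]; exists y; split => [i|i j /yr].
  exact: lt_le_trans ss.
exact: le_lt_trans.
Qed.

Lemma open_packing n (s r : R) :
  open [set t : trees R | packing (tree_repr t) n s r].
Proof.
move=> t /= [y [ys yr]].
have [|e1 e10 e1P] := @finite_pos_lower_bound R 'I_n (enum 'I_n)
    (fun i => s - height (y i)).
  by move=> i _; rewrite subr_gt0.
have [|e2 e20 e2P] := @finite_pos_lower_bound R ('I_n * 'I_n)%type
    (enum {: 'I_n * 'I_n})
    (fun p => if p.1 != p.2 then mdist (y p.1) (y p.2) - r else 1).
  by move=> [i j] _ /=; case: ifP => // /yr; lra.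
pose e := Num.min e1 e2 / 2.
have [m1 m2] : Num.min e1 e2 <= e1 /\ Num.min e1 e2 <= e2.
  by rewrite !ge_min !lexx orbT.
have e0 : 0 < e by rewrite divr_gt0// lt_min e10.
have [eta eta0 etaP] := delta_transport y e0.
exists eta => // u /etaP[z [zh zd]]; exists z; split => [i|i j ij].
  have := e1P i; rewrite mem_enum => /(_ isT).
  by have := zh i; rewrite ler_norml /e in e0 * => /andP[+ _]; lra.
have := e2P (i, j); rewrite mem_enum /= ij => /(_ isT).
by have := zd i j; rewrite ler_norml /e in e0 * => /andP[_]; lra.
Qed.

(** Absence of a packing is a closed condition; asking for it with a margin [e] makes it open. Here
    a packing of the nearby tree is pulled back to [t]. *)
Lemma open_packing_lt n (s r : R) : open [set t : trees R |
  exists2 e : R, 0 < e & ~ packing (tree_repr t) n (s + e) (r - e)].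
Proof.
move=> t /= [e e0 nt].
have e20 : 0 < e / 2 by rewrite divr_gt0.
have [k k1 ks] := finite_upper_bound (fun _ : 'I_1 => s + e).
have {}ks : s + e <= k%:R := ks ord0.
have [eta eta0 etaP] := @tree_delta_lt_correspondence R k (e / 2) k1 e20.
exists eta => // u /etaP[C CC]; exists (e / 2) => // -[y [ys yr]]; apply: nt.
have [_ Cd _ C21] := CC.
have /choice[z zP] i : exists z, C z (y i).
  have [|z _ Cz] := C21 (y i); last by exists z.
  by rewrite /root_ball/= -/(height _); have := ys i; lra.
exists z; split => [i|i j /yr].
  have := ball_correspondence_height CC (zP i); have := ys i.
  by rewrite ler_norml => ? /andP[_]; lra.
by have := Cd _ _ _ _ (zP i) (zP j); rewrite ler_norml => /andP[+ _]; lra.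
Qed.

End open_sets.

Section level_counts.
Context {R : realType}.
Implicit Types (t u : trees R) (h a : R).

Lemma level_countP h a t n : 0 < h -> 0 < a ->
  (n <= level_count h a t)%N <-> spread (tree_repr t) n a (a + h).
Proof. exact: tree_level_countP. Qed.

Lemma open_measurable_trees (U : set (trees R)) : open U -> measurable U.
Proof. by move=> oU; exact: sub_sigma_algebra. Qed.

Lemma measurable_level_count_ge h a n : 0 < h -> 0 < a ->
  measurable [set t : trees R | (n <= level_count h a t)%N].
Proof.
move=> h0 a0.
rewrite (_ : [set _ | _]
  = \bigcup_k \bigcap_m [set t | open_spread (tree_repr t)
    n (a - k.+1%:R^-1) (a + h - m.+1%:R^-1)]).
  apply: bigcupT_measurable => k; apply: bigcapT_measurable => m.
  by apply: open_measurable_trees; exact: open_open_spread.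
have ah : 0 <= a + h by rewrite addr_ge0// ltW.
apply/seteqP; split => t /=.
  move=> nt; have /(level_countP t n h0 a0) := nt.
  by move/(@spread_countable R _ n a _ ah) => -[k km]; exists k => // m _;
    exact: km.
move=> [k _ km]; apply/(level_countP t n h0 a0)/(@spread_countable R _ n a _
  ah).
by exists k => m; exact: km.
Qed.

Lemma measurable_nat_preimage (f : trees R -> nat) :
  (forall n, measurable [set t | (n <= f t)%N]) ->
  forall A : set nat, measurable (f @^-1` A).
Proof.
move=> mf A; rewrite (_ : _ @^-1` _ = \bigcup_(n in A)
    ([set t | (n <= f t)%N] `\` [set t | (n.+1 <= f t)%N])).
  by apply: bigcup_measurable => n _; exact: measurableD.
apply/seteqP; split => [t At|t [n An /= [nf /negP]]].
  by exists (f t) => //=; split => //; rewrite ltnn.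
by rewrite -leqNgt => fn; suff -> : f t = n by []; apply/eqP;
  rewrite eqn_leq fn.
Qed.

(** All counts at levels in (a, a + h / 2) are at most [N], so only finitely many conditions
    [spread n b (b + h)] have to stabilise. In particular the [lim] defining [level_count_right] is
    a genuine limit. *)
Lemma level_count_right_spec h a t : 0 < h -> 0 < a ->
  \forall b \near a^'+, level_count h b t = level_count_right h a t.
Proof.
move=> h0 a0.
have [||N NP] := @spread_bounded R (tree_repr t) (a + h / 2) (a + h).
- lra.
- lra.
have F : ProperFilter (nbhs a^'+) by exact: at_right_proper_filter.
have near_lt (d : R) : a < d -> \forall b \near a^'+, a < b /\ b < d.
  move=> ad; near=> b; split; near: b; first exact: nbhs_right_gt.
  exact: nbhs_right_lt.
pose Q (n : 'I_N.+1) :=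
  \forall b \near a^'+, spread (tree_repr t) n b (b + h).
have nearQ : forall n : 'I_N.+1, \forall b \near a^'+,
    spread (tree_repr t) n b (b + h) <-> Q n.
  move=> n.
  have [ev|nev] := spread_right_limit (tree_repr t) n (ltW a0) h0.
    by apply: filterS (ev).
  apply: filterS (nev) => b nb; split => // Qn.
  by have [b' [sb nsb]] := filter_ex (filterI Qn nev).
have stable : \forall b \near a^'+, (a < b /\ b < a + h / 2) /\
    forall n : 'I_N.+1, spread (tree_repr t) n b (b + h) <-> Q n.
  apply: filterI; first by apply: near_lt; lra.
  exact: filter_forall nearQ.
have le b b' : (a < b /\ b < a + h / 2) ->
    (forall n : 'I_N.+1, spread (tree_repr t) n b (b + h) <-> Q n) ->
    a < b' -> (forall n : 'I_N.+1, spread (tree_repr t) n b' (b' + h) <-> Q n)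
      ->
    (level_count h b t <= level_count h b' t)%N.
  move=> [ab bh] bQ ab' b'Q.
  have sb : spread (tree_repr t) (level_count h b t) b (b + h).
    by apply/level_countP => //; exact: lt_trans ab.
  have nN : (level_count h b t < N.+1)%N.
    by rewrite ltnS; apply: NP; apply: spread_monotone sb; lra.
  apply/level_countP => //; first exact: lt_trans ab'.
  by apply/(b'Q (Ordinal nN))/(bQ (Ordinal nN)).
have [b0 [b0a b0Q]] := filter_ex stable.
have cst : \forall b \near a^'+, level_count h b t = level_count h b0 t.
  apply: (filterS _ stable) => b [ba bQ]; apply/eqP.
  by rewrite eqn_leq (le _ _ ba bQ b0a.1 b0Q) (le _ _ b0a b0Q ba.1 bQ).
suff -> : level_count_right h a t = level_count h b0 t by [].
rewrite /level_count_right; apply: lim_near_cst cst.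
exact: order_hausdorff.
Unshelve. all: by end_near.
Qed.

Lemma measurable_level_count_right_ge h a n : 0 < h -> 0 < a ->
  measurable [set t : trees R | (n <= level_count_right h a t)%N].
Proof.
move=> h0 a0.
(* Along the levels a + 1 / (j + 1) the count eventually equals its right limit, so the inequality
   for the limit means the inequality for all large j. *)
rewrite (_ : [set _ | _] = \bigcup_K \bigcap_k [set t |
    (n <= level_count h (a + (K + k).+1%:R^-1) t)%N]).
  apply: bigcupT_measurable => K; apply: bigcapT_measurable => k.
  by apply: measurable_level_count_ge => //; rewrite addr_gt0// invr_gt0 ltr0n.
apply/seteqP; split => t /=.
  move=> nt; have := level_count_right_spec t h0 a0.
  rewrite /at_right => -[e /= e0 eP].
  have [K _ KP] := near_infty_natSinv_lt (PosNum e0).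
  exists K => // k _ /=; rewrite eP//=; last first.
    by rewrite ltrDl invr_gt0 ltr0n.
  rewrite opprD addrA subrr add0r normrN gtr0_norm ?invr_gt0 ?ltr0n//.
  by apply: KP => /=; exact: leq_addr.
move=> [K _ KP]; have := level_count_right_spec t h0 a0.
rewrite /at_right => -[e /= e0 eP].
have [k _ kP] := near_infty_natSinv_lt (PosNum e0).
have := KP k I; rewrite /= eP//=.
  rewrite opprD addrA subrr add0r normrN gtr0_norm ?invr_gt0 ?ltr0n//.
  by apply: kP => /=; exact: leq_addl.
by rewrite ltrDl invr_gt0 ltr0n.
Qed.

Lemma level_count_le_right h a t : 0 < h -> 0 < a ->
  (level_count h a t <= level_count_right (h / 2) a t)%N.
Proof.
move=> h0 a0; have h20 : 0 < h / 2 by rewrite divr_gt0.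
have F : ProperFilter (nbhs a^'+) by exact: at_right_proper_filter.
have ah : \forall b \near a^'+, a < b /\ b < a + h / 2.
  near=> b; split; near: b; first exact: nbhs_right_gt.
  by apply: nbhs_right_lt; lra.
have [b [<- [ab bh]]] :=
  filter_ex (filterI (level_count_right_spec t h20 a0) ah).
apply/level_countP => //; first exact: lt_trans ab.
have : spread (tree_repr t) (level_count h a t) a (a + h) by exact/level_countP.
by apply: spread_monotone; lra.
Unshelve. all: by end_near.
Qed.

Lemma level_count_right_le h a t : 0 < h -> 0 < a ->
  (level_count_right h a t <= level_count (h / 2) (a + h / 2) t)%N.
Proof.
move=> h0 a0; have h20 : 0 < h / 2 by rewrite divr_gt0.
have F : ProperFilter (nbhs a^'+) by exact: at_right_proper_filter.
have ah : \forall b \near a^'+, a < b /\ b < a + h / 2.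
  near=> b; split; near: b; first exact: nbhs_right_gt.
  by apply: nbhs_right_lt; lra.
have [b [<- [ab bh]]] :=
  filter_ex (filterI (level_count_right_spec t h0 a0) ah).
have b0 : 0 < b by exact: lt_trans ab.
apply/level_countP; [done|lra|].
have : spread (tree_repr t) (level_count h b t) b (b + h) by exact/level_countP.
by apply: spread_monotone; lra.
Unshelve. all: by end_near.
Qed.

End level_counts.

(** * Ultralimits of trees *)

Lemma packing_le (R : realType) (T : clcr_tree R) n n' (s r : R) :
  (n <= n')%N -> packing T n' s r -> packing T n s r.
Proof.
move=> nn [y [ys yr]]; exists (fun i => y (widen_ord nn i)).
by split => // i j ij; apply: yr.
Qed.

(** A packing of maximal size is a net. It is padded with the root so that its index set is the same
    for all trees. *)
Lemma maximal_packing_net (R : realType) (T : clcr_tree R) (L : nat) (s r : R) :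
  ~ packing T L.+1 s r -> exists x : nat -> T,
    (forall i, height (x i) <= Num.max s 0) /\
    forall z, height z < s -> exists i : 'I_L.+1, mdist z (x i) <= r.
Proof.
move=> nL; pose P n := `[< packing T n s r >].
have P0 : exists n, P n.
  by exists 0%N; apply/asboolP; exists (fun=> tree_root T); split => -[].
have PL n : P n -> (n <= L)%N.
  move/asboolP => pn; rewrite leqNgt; apply/negP => Ln; apply: nL.
  exact: packing_le pn.
have [n /[dup] Pn /asboolP[y [ys yr]] nmax] := ex_maxnP P0 PL.
exists (fun i => if insub i is Some k then y k else tree_root T).
split => [i|z zs].
  by case: insubP => [k _ _|_];
    rewrite le_max ?(ltW (ys _))// /height mdistxx lexx orbT.
apply: contrapT => nz.
have zr i : r < mdist z (y i).
  rewrite ltNge; apply/negP => zy; apply: nz.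
  exists (widen_ord (leqW (PL _ Pn)) i) => /=.
  by rewrite (valK i).
suff /nmax : P n.+1 by rewrite ltnn.
apply/asboolP.
exists (fun i : 'I_n.+1 => if unlift ord0 i is Some j then y j else z).
split=> [i|i j]; first by case: unliftP.
case: unliftP => [i' ->|->]; case: unliftP => [j' ->|->].
- by rewrite (inj_eq lift_inj) => /yr.
- by move=> _; rewrite metric_sym.
- by move=> _; exact: zr.
- by rewrite eqxx.
Qed.

(** The four-point condition makes approximate interpolants close to one another: they generate a
    Cauchy filter, whose limit is an exact interpolant. *)
Lemma approx_interpolable (R : realType) (T : metricType R) :
  is_complete T -> four_point T ->
  (forall (x y : T) (s e : R), 0 <= s <= mdist x y -> 0 < e ->
    exists z, mdist x z <= s + e /\ mdist z y <= mdist x y - s + e) ->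
  interpolable T.
Proof.
move=> cT T4 Te x y s sxy.
pose F := filter_from [set e : R | 0 < e]
  (fun e => [set z | mdist x z <= s + e /\ mdist z y <= mdist x y - s + e]).
have FF : ProperFilter F.
  apply: filter_from_proper; last by move=> e /(Te _ _ _ _ sxy).
  apply: filter_from_filter; first by exists 1 => /=.
  move=> e e' /= e0 e'0; exists (Num.min e e'); first by rewrite /= lt_min e0.
  move=> z /= []; have : Num.min e e' <= e by rewrite ge_min lexx.
  have : Num.min e e' <= e' by rewrite ge_min lexx orbT.
  by move=> *; do 2!split; lra.
have [|z Fz] := cT F FF.
  apply/mdist_cauchyP => e e0.
  have e40 : 0 < e / 4 by rewrite divr_gt0.
  have [w [xw wy]] := Te _ _ _ _ sxy e40.
  exists w; exists (e / 4) => // z [xz zy] /=.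
  have := T4 w z x y; rewrite (metric_sym w x) (metric_sym z x) le_max.
  by move=> /orP[]; lra.
exists z.
have near (e : R) : 0 < e ->
    mdist x z <= s + e /\ mdist z y <= mdist x y - s + e.
  move=> e0; have e20 : 0 < e / 2 by rewrite divr_gt0.
  have Fe : F [set w | mdist x w <= s + e / 2 /\
    mdist w y <= mdist x y - s + e / 2].
    by exists (e / 2).
  have /mdist_cvgP/(_ _ e20)/filterI/(_ Fe)/filter_ex[w [/= zw [xw wy]]] := Fz.
  have := metric_triangle x w z; have := metric_triangle z w y.
  by rewrite (metric_sym w z); lra.
have xz : mdist x z <= s by apply/ler_addgt0Pl => e /near; lra.
have zy : mdist z y <= mdist x y - s by apply/ler_addgt0Pl => e /near; lra.
by have := metric_triangle x z y; lra.
Qed.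

Definition mesh (R : realType) (m : nat) : R := m.+1%:R^-1.

Section ultralimit.
Context {R : realType} (U : Type) (F : set_system U) (T_ : U -> clcr_tree R).
Context {UF : UltraFilter F}.
Variable L : nat -> nat -> nat.
Hypothesis TL : F [set u | forall s m, ~ packing (T_ u) (L s m).+1 s%:R (mesh R
  m)].

(** An index consists of a height bound, a mesh index and a rank in the net. The height bound of [o]
    is 0, so [o] always denotes the root. *)
Local Notation I := (nat * nat * nat)%type.
Local Notation o := (0, 0, 0)%N.

Lemma mesh_gt0 m : 0 < mesh R m.
Proof. by rewrite /mesh invr_gt0 ltr0n. Qed.

Lemma mesh_lt (e : R) : 0 < e -> exists m, mesh R m < e.
Proof.
by move=> e0; have [m _ /(_ m (leqnn m))] := near_infty_natSinv_lt (PosNum e0);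
  exists m.
Qed.

Lemma net_exists u : exists x : I -> T_ u,
  (forall i, height (x i) <= i.1.1%:R) /\
  ((forall s m, ~ packing (T_ u) (L s m).+1 s%:R (mesh R m)) ->
   forall s m z, height z < s%:R ->
     exists i : 'I_(L s m).+1, mdist z (x (s, m, val i)) <= mesh R m).
Proof.
have /choice[f fP] (p : nat * nat) : exists x : nat -> T_ u,
    (forall i, height (x i) <= p.1%:R) /\
    (~ packing (T_ u) (L p.1 p.2).+1 p.1%:R (mesh R p.2) ->
     forall z, height z < p.1%:R ->
       exists i : 'I_(L p.1 p.2).+1, mdist z (x i) <= mesh R p.2).
  have [/maximal_packing_net[x [xs xn]]|pk] :=
      pselect (~ packing (T_ u) (L p.1 p.2).+1 p.1%:R (mesh R p.2)).
    by exists x; split => // i; rewrite (le_trans (xs i))// ge_max lexx ler0n.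
  by exists (fun=> tree_root (T_ u)); split => // i; rewrite /height mdistxx.
exists (fun i => f i.1 i.2); split => [[[s m] i]|npk s m z zs] /=.
  exact: (fP (s, m)).1.
by apply: (fP (s, m)).2 => //; exact: npk.
Qed.

Definition net u : I -> T_ u := sval (cid (net_exists u)).

Lemma net_height u i : height (net u i) <= i.1.1%:R.
Proof. exact: (proj2_sig (cid (net_exists u))).1. Qed.

Lemma net_root u : net u o = tree_root (T_ u).
Proof. by apply/esym/mdist_eq0; exact: net_height. Qed.

Lemma netP : F [set u | forall s m z, height z < s%:R ->
  exists i : 'I_(L s m).+1, mdist z (net u (s, m, val i)) <= mesh R m].
Proof.
by apply: filterS TL => u; exact: (proj2_sig (cid (net_exists u))).2.
Qed.

Lemma limit_dist_exists (p : I * I) : exists l : R, forall e : R, 0 < e ->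
  F [set u | `|mdist (net u p.1) (net u p.2) - l| < e].
Proof.
pose f u := mdist (net u p.1) (net u p.2).
have := @segment_compact R 0 (p.1.1.1%:R + p.2.1.1%:R).
rewrite compact_ultra => /(_ _ (ultra_fmap f UF)); case.
  apply: (@filterE _ F _ (f @^-1` _)) => u /=; rewrite in_itv/= /f mdist_ge0/=.
  have := metric_triangle (net u p.1) (tree_root _) (net u p.2).
  rewrite (metric_sym _ (tree_root _)) => /le_trans; apply.
  by apply: lerD; exact: net_height.
move=> l [_ /= fl]; exists l => e e0.
have : nbhs l [set r | `|l - r| < e] by apply: nbhsx_ballx.
move=> /fl fF; apply: (filterS _ (fF : F (f @^-1` _))) => u /=.
by rewrite distrC.
Qed.

Definition limit_dist (i j : I) : R := sval (cid (limit_dist_exists (i, j))).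

(** Through this lemma any inequality between finitely many distances, such as the four-point
    condition, passes to [limit_dist] up to arbitrarily small errors. *)
Lemma limit_dist_near (s : seq (I * I)) (e : R) : 0 < e ->
  F [set u | forall i j,
  (i, j) \in s -> `|mdist (net u i) (net u j) - limit_dist i j| < e].
Proof.
move=> e0; elim: s => [|[i j] s ih]; first by apply: filterE.
have := proj2_sig (cid (limit_dist_exists (i, j))) e e0.
move=> /filterI/(_ ih); apply: filterS => u /= [uij us] i' j'.
by rewrite inE => /predU1P[[-> ->]|/us].
Qed.

Lemma limit_dist_le i j (r : R) : F [set u | mdist (net u i) (net u j) <= r] ->
  limit_dist i j <= r.
Proof.
move=> Fr; apply/ler_addgt0Pl => e /(limit_dist_near [::
  (i, j)])/filterI/(_ Fr).
move=> /filter_ex[u [/= /(_ i j (mem_head _ _))]].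
by rewrite ltr_norml => /andP[+ _]; lra.
Qed.

Lemma limit_distxx i : limit_dist i i = 0.
Proof.
apply/eqP; rewrite -normr_le0; apply/ler_addgt0Pl => e.
move=> /(limit_dist_near [:: (i, i)])/filter_ex[u /(_ i i (mem_head _ _))].
by rewrite mdistxx sub0r normrN addr0 => /ltW.
Qed.

Lemma limit_dist_sym i j : limit_dist i j = limit_dist j i.
Proof.
apply/eqP; rewrite -subr_eq0 -normr_le0; apply/ler_addgt0Pl => e e0.
have [|u ue] := filter_ex (limit_dist_near [:: (i, j); (j, i)] (e := e / 2) _).
  by rewrite divr_gt0.
have := ue i j; have := ue j i; rewrite !inE !eqxx !orbT => /(_ isT) + /(_ isT).
rewrite (metric_sym (net u j)) !ltr_norml ler_norml => /andP[? ?] /andP[? ?].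
by apply/andP; split; lra.
Qed.

Lemma limit_dist_triangle j i k :
  limit_dist i k <= limit_dist i j + limit_dist j k.
Proof.
apply/ler_addgt0Pl => e e0.
have [|u ue] := filter_ex (limit_dist_near [:: (i, k); (i, j);
  (j, k)] (e := e / 3) _).
  by rewrite divr_gt0.
have := ue i k; have := ue i j; have := ue j k; rewrite !inE !eqxx !orbT.
move=> /(_ isT) + /(_ isT) + /(_ isT); rewrite !ltr_norml.
move=> /andP[? ?] /andP[? ?] /andP[? ?].
by have := metric_triangle (net u i) (net u j) (net u k); lra.
Qed.

Lemma limit_dist_four_point i j k l :
  limit_dist i j + limit_dist k l <= Num.max (limit_dist i k + limit_dist j l)
    (limit_dist i l + limit_dist j k).
Proof.
apply/ler_addgt0Pl => e e0.
have [|u ue] := filter_ex (limit_dist_near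
    [:: (i, j); (k, l); (i, k); (j, l); (i, l); (j, k)] (e := e / 4) _).
  by rewrite divr_gt0.
have := ue i j; have := ue k l; have := ue i k; have := ue j l; have := ue i l.
have := ue j k; rewrite !inE !eqxx !orbT.
move=> /(_ isT) + /(_ isT) + /(_ isT) + /(_ isT) + /(_ isT) + /(_ isT).
rewrite !ltr_norml.
move=> /andP[? ?] /andP[? ?] /andP[? ?] /andP[? ?] /andP[? ?] /andP[? ?].
have := real_tree_four_point (@clcr_real_tree R (T_ u)) (net u i) (net u j)
  (net u k) (net u l).
rewrite -lerBlDl !le_max => /orP[?|?]; apply/orP; [left|right]; lra.
Qed.

Definition ultralimit_space : metric_space R :=
  completion o limit_dist_sym limit_dist_triangle.
Local Notation X := ultralimit_space.
Definition limit_point (i : I) : X :=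
  completion_point o limit_dist_sym limit_dist_triangle i.

Lemma limit_pointE i j : mdist (limit_point i) (limit_point j) = limit_dist i j.
Proof. exact: (completion_pointE o limit_distxx). Qed.

Lemma ultralimit_dense (f : X) (e : R) : 0 < e ->
  exists i, mdist f (limit_point i) <= e.
Proof. exact: completion_dense. Qed.

Lemma ultralimit_complete : is_complete X.
Proof. exact: completion_complete. Qed.

Lemma ultralimit_four_point : four_point X.
Proof.
move=> a b c d; apply/ler_addgt0Pl => e e0.
have e80 : 0 < e / 8 by rewrite divr_gt0.
have [i ai] := ultralimit_dense a e80; have [j bj] := ultralimit_dense b e80.
have [k ck] := ultralimit_dense c e80; have [l dl] := ultralimit_dense d e80.
have close (f g : X) i' j' : mdist f (limit_point i') <= e / 8 ->
    mdist g (limit_point j') <= e / 8 ->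
    mdist f g <= limit_dist i' j' + e / 4 /\
      limit_dist i' j' <= mdist f g + e / 4.
  move=> fi gj; rewrite -limit_pointE.
  have := metric_triangle f (limit_point i') g;
    have := metric_triangle (limit_point i') (limit_point j') g.
  have := metric_triangle (limit_point i') f (limit_point j');
    have := metric_triangle f g (limit_point j').
  by rewrite (metric_sym (limit_point j') g) (metric_sym (limit_point i') f);
    lra.
have [h1 _] := close _ _ _ _ ai bj; have [h2 _] := close _ _ _ _ ck dl.
have [_ h3] := close _ _ _ _ ai ck; have [_ h4] := close _ _ _ _ bj dl.
have [_ h5] := close _ _ _ _ ai dl; have [_ h6] := close _ _ _ _ bj ck.
have := limit_dist_four_point i j k l.
by rewrite -lerBlDl !le_max => /orP[?|?]; apply/orP; [left|right]; lra.
Qed.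

Lemma ultralimit_net s m (f : X) : mdist (limit_point o) f < s%:R ->
  exists i : 'I_(L s m).+1, mdist f (limit_point (s, m, val i)) <= 2 * mesh R m.
Proof.
move=> fs; have m0 := mesh_gt0 m.
(* Besides being at most the mesh, the error must keep [limit_point j] strictly below height [s], so
   that the nets of the trees [T_ u] apply to [net u j]. *)
pose e := Num.min (mesh R m) ((s%:R - mdist (limit_point o) f) / 2).
have em : e <= mesh R m by rewrite ge_min lexx.
have es : e <= (s%:R - mdist (limit_point o) f) / 2 by rewrite ge_min lexx orbT.
have e0 : 0 < e by rewrite lt_min m0 divr_gt0// subr_gt0.
have [j fj] := ultralimit_dense f e0.
have Dj : limit_dist o j < s%:R.
  by rewrite -limit_pointE;
    have := metric_triangle (limit_point o) f (limit_point j); lra.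
have : F [set u | exists i : 'I_(L s m).+1,
    mdist (net u j) (net u (s, m, val i)) <= mesh R m].
  have /(limit_dist_near [:: (o, j)])/filterI/(_ netP) :
    0 < s%:R - limit_dist o j.
    by rewrite subr_gt0.
  apply: filterS => u /= [/(_ o j (mem_head _ _)) + netu]; rewrite net_root.
  by rewrite ltr_norml => /andP[_ ju]; apply: netu; rewrite /height; lra.
move=> /ultra_finite_exists[i /limit_dist_le]; rewrite -limit_pointE => ji;
  exists i.
by have := metric_triangle f (limit_point j) (limit_point (s, m, val i)); lra.
Qed.

Lemma ultralimit_ball_totally_bounded (c : R) : totally_bounded [set f :
  X | mdist (limit_point o) f <= c].
Proof.
move=> e e0; have [m me] := @mesh_lt (e / 2) ltac:(by rewrite divr_gt0).
pose s := (Num.bound `|c|).+1.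
have cs : c < s%:R.
  apply: le_lt_trans (ler_norm c) _.
  apply: lt_le_trans (archi_boundP (normr_ge0 c)) _.
  by rewrite ler_nat.
exists [seq limit_point (s, m, val i) | i <- enum 'I_(L s m).+1] => f /= fc.
have [i fi] := ultralimit_net m (le_lt_trans fc cs).
exists (limit_point (s, m, val i)); first by apply: map_f; rewrite mem_enum.
by rewrite metric_sym; lra.
Qed.

Lemma ultralimit_locally_compact : locally_compact [set: X].
Proof.
move=> f _; rewrite withinET.
exists [set g : X | mdist (limit_point o) g <= mdist (limit_point o) f + 1].
  apply/mdist_nbhsP; exists 1 => // g fg /=.
  by have := metric_triangle (limit_point o) f g; lra.
split; last exact: (@closed_mball R X).
apply: totally_bounded_compact; first exact: ultralimit_complete.
  exact: (@closed_mball R X).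
exact: ultralimit_ball_totally_bounded.
Qed.

(** Points are interpolated inside the trees [T_ u] and rounded to net points. The pigeonhole fixes
    the index of the rounded point, whose limit is an approximate interpolant. *)
Lemma ultralimit_interpolable : interpolable X.
Proof.
apply: approx_interpolable;
  [exact: ultralimit_complete|exact: ultralimit_four_point|].
move=> f g s e /andP[s0 sfg] e0.
have e80 : 0 < e / 8 by rewrite divr_gt0.
have [i fi] := ultralimit_dense f e80; have [j gj] := ultralimit_dense g e80.
have Dij : limit_dist i j <= mdist f g + e / 4.
  rewrite -limit_pointE;
    have := metric_triangle (limit_point i) f (limit_point j).
  by have := metric_triangle f g (limit_point j);
    rewrite (metric_sym (limit_point i) f); lra.
have [m me] := mesh_lt e80.
pose S := (i.1.1 + (Num.bound s).+1)%N.
have sS : i.1.1%:R + s < S%:R.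
  rewrite /S natrD ltrD2l; apply: lt_le_trans (archi_boundP s0) _.
  by rewrite ler_nat.
have : F [set u | exists k : 'I_(L S m).+1,
    mdist (net u i) (net u (S, m, val k)) <= s + e / 8 /\
    mdist (net u (S, m, val k)) (net u j) <= mdist f g - s + e / 2].
  have /filterI/(_ netP) := limit_dist_near [:: (i, j)] e80.
  apply: filterS => u /= [/(_ i j (mem_head _ _)) + netu].
  rewrite ltr_norml => /andP[_ uij].
  (* The distance between the two net points of [T_ u] may fall short of [s]; the interpolant is
     then [net u j] itself. *)
  pose s' := Num.min s (mdist (net u i) (net u j)).
  have s's : s' <= s by rewrite ge_min lexx.
  have [|z [iz zj]] := real_tree_interpolable (@clcr_real_tree R (T_ u))
      (x := net u i) (y := net u j) (s := s').
    by rewrite le_min s0 mdist_ge0 ge_min lexx orbT.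
  have [|k zk] := netu S m z.
    apply: le_lt_trans sS; apply: le_trans (metric_triangle _ (net u i) _) _.
    by apply: lerD; [exact: net_height|rewrite iz].
  exists k.
  have := metric_triangle (net u i) z (net u (S, m, val k)).
  have := metric_triangle (net u (S, m, val k)) z (net u j).
  rewrite (metric_sym _ z) zj iz => t1 t2; split; first lra.
  have [sd|ds] := leP s (mdist (net u i) (net u j)).
    by move: t1; rewrite /s' min_l//; lra.
  by move: t1; rewrite /s' min_r ?(ltW ds)//; lra.
move=> /ultra_finite_exists[k Fk]; exists (limit_point (S, m, val k)).
have Dik : limit_dist i (S, m, val k) <= s + e / 8.
  by apply: limit_dist_le; apply: filterS Fk => u [].
have Dkj : limit_dist (S, m, val k) j <= mdist f g - s + e / 2.
  by apply: limit_dist_le; apply: filterS Fk => u [].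
rewrite -limit_pointE in Dik; rewrite -limit_pointE in Dkj.
have := metric_triangle f (limit_point i) (limit_point (S, m, val k)).
by have := metric_triangle (limit_point (S, m, val k)) (limit_point j) g;
  rewrite (metric_sym (limit_point j) g); lra.
Qed.

Definition ultralimit : clcr_tree R :=
  @ClcrTree R X (limit_point o) (four_point_real_tree ultralimit_four_point
    ultralimit_interpolable)
    ultralimit_complete ultralimit_locally_compact.

(** Points are related when they are close to net points of the same index. A given ball involves
    finitely many indices, whose distances are all close to their limits for most [u]. *)
Lemma ultralimit_correspondence k (e : R) : 0 < e ->
  F [set u | exists C, ball_correspondence ultralimit (T_ u) k e C].
Proof.
(* The distortion is at most 13 meshes: 3 for each of the four points related to net points, and 1
   for the convergence of distances. *)
move=> e0; have [m me] := @mesh_lt (e / 13) ltac:(by rewrite divr_gt0).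
have m0 := mesh_gt0 m.
pose s := k.+1; pose J := o :: [seq (s, m, val i) | i <- enum 'I_(L s m).+1].
have kJ (i : 'I_(L s m).+1) : (s, m, val i) \in J.
  by rewrite inE; apply/orP; right; apply: (map_f (fun i => (s, m, val i)));
    rewrite mem_enum.
have oJ : o \in J by rewrite inE eqxx.
have ks : k%:R < s%:R :> R by rewrite ltr_nat.
have /filterI/(_ netP) :=
  limit_dist_near [seq (i, j) | i <- J, j <- J] (mesh_gt0 m).
apply: filterS => u [uJ' netu].
have {uJ'}uJ i j : i \in J -> j \in J ->
    `|mdist (net u i) (net u j) - limit_dist i j| < mesh R m.
  by move=> iJ jJ; apply: uJ'; exact: allpairs_f.
exists (fun f y => exists i, [/\ i \in J, mdist f (limit_point i) <= 3 * mesh R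
  m &
  mdist y (net u i) <= 3 * mesh R m]).
split.
- by exists o; rewrite net_root !mdistxx; split => //; lra.
- move=> f y f' y' [i [iJ fi yi]] [i' [i'J f'i y'i]].
  have := uJ _ _ iJ i'J;
    rewrite -limit_pointE ltr_norml ler_norml => /andP[u1 u2].
  have := metric_triangle f (limit_point i) f';
    have := metric_triangle (limit_point i) (limit_point i') f'.
  have := metric_triangle (limit_point i) f (limit_point i');
    have := metric_triangle f f' (limit_point i').
  have := metric_triangle y (net u i) y';
    have := metric_triangle (net u i) (net u i') y'.
  have := metric_triangle (net u i) y (net u i');
    have := metric_triangle y y' (net u i').
  rewrite (metric_sym (limit_point i') f') (metric_sym (limit_point i) f).
  rewrite (metric_sym (net u i') y') (metric_sym (net u i) y) => *.
  by apply/andP; split; lra.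
- move=> f; rewrite /root_ball/= => fk.
  have [i fi] := ultralimit_net m (le_lt_trans fk ks).
  (* The net point may leave the ball, by at most 3 meshes: 2 in the limit and 1 for the
     convergence. Truncation brings it back. *)
  have [y [yk yx]] := truncation (net u (s, m, val i)) (ler0n R k).
  exists y; first by rewrite /= -/(height y) yk ge_min lexx orbT.
  exists (s, m, val i); split => //; first lra.
  rewrite yx; have := uJ _ _ oJ (kJ i);
    rewrite -limit_pointE net_root -/(height _).
  have := metric_triangle (limit_point o) f (limit_point (s, m, val i)).
  rewrite ltr_norml => ? /andP[_ ?].
  have [hk|hk] := leP (height (net u (s, m, val i))) k%:R.
    by rewrite yk min_l//; lra.
  by rewrite yk min_r ?(ltW hk)//; lra.
- move=> y; rewrite /root_ball/= => yk.
  have [i yi] := netu s m y (le_lt_trans yk ks).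
  have [f [fk fx]] := @truncation _ ultralimit (limit_point (s, m, val i)) _
    (ler0n R k).
  exists f; first by rewrite /= -/(height f) fk ge_min lexx orbT.
  exists (s, m, val i); split => //; last lra.
  rewrite fx; have := uJ _ _ oJ (kJ i);
    rewrite -limit_pointE net_root -!/(height _).
  have := metric_triangle (tree_root _) y (net u (s, m, val i)).
  rewrite -!/(height _) ltr_norml => ? /andP[? _].
  have {}yk : height y <= k%:R by [].
  have hyp : mdist (limit_point o) (limit_point (s, m, val i)) <= 3 * mesh R m
    + k%:R.
    lra.
  have [hk|hk] := leP (height (limit_point (s, m, val i) : ultralimit)) k%:R.
    by rewrite fk min_l// subrr; lra.
  by rewrite fk min_r ?(ltW hk)// lerBlDr; exact: hyp.
Qed.

End ultralimit.

(** * Compact sets of trees *)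

Section compact_sets_of_trees.
Context {R : realType}.

Lemma tree_repr_class (T : clcr_tree R) :
  tree_equiv (tree_repr (tree_class T)) T.
Proof.
have : tree_class (tree_repr (tree_class T)) = tree_class T by exact: reprK.
by move/eqquotP/asboolP.
Qed.

(** Neighbourhoods are defined through representatives, so what holds for the ultralimit is moved to
    the representative of its class. *)
Lemma ball_correspondence_equiv (T1 T1' T2 : clcr_tree R) k (e : R) C :
  tree_equiv T1' T1 -> ball_correspondence T1 T2 k e C ->
  exists C', ball_correspondence T1' T2 k e C'.
Proof.
move=> [f [fi fs fr]] [Cr Cd C12 C21]; exists (fun x y => C (f x) y); split.
- by rewrite fr.
- by move=> x y x' y' Cxy Cxy'; rewrite -fi; exact: Cd.
- by move=> x xk; apply: C12; rewrite /root_ball/= -fr fi.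
- move=> y /C21[x xk Cxy]; have [x' x'E] := fs x.
  by exists x'; rewrite ?x'E// /root_ball/= -fi fr x'E.
Qed.

Definition packing_bounded (L : nat -> nat -> nat) : set (trees R) :=
  [set t | forall s m, ~ packing (tree_repr t) (L s m).+1 s%:R (mesh R m)].

Lemma packing_bounded_closed L : closed (packing_bounded L).
Proof.
rewrite (_ : packing_bounded L = ~` \bigcup_s \bigcup_m
    [set t | packing (tree_repr t) (L s m).+1 s%:R (mesh R m)]).
  apply: open_closedC; apply: bigcup_open => s _; apply: bigcup_open => m _.
  exact: open_packing.
apply/seteqP; split => [t tL [s _ [m _]]|t tL s m ts]; first exact: tL.
by apply: tL; exists s => //; exists m.
Qed.

Lemma packing_bounded_compact L : compact (packing_bounded L).
Proof.
rewrite compact_ultra => F UF FL.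
pose T := @ultralimit R (trees R) F (@tree_repr R) UF L FL.
pose t := tree_class T.
have Ft : F --> t.
  move=> A; rewrite nbhsE => -[V [oV Vt] VA].
  have [eta eta0 etaO] := oV _ Vt.
  have [m [e [e0 me]]] := tree_delta_lt_of_correspondence eta0.
  have : F [set u | forall k : 'I_m,
      exists C, ball_correspondence T (tree_repr u) k e C].
    by apply: filter_forall => k; exact: ultralimit_correspondence.
  apply: filterS => u uC; apply/VA/etaO/me => k /andP[_ km].
  have [C CC] := uC (Ordinal km).
  exact: ball_correspondence_equiv (tree_repr_class _) CC.
exists t; split => //; apply: packing_bounded_closed => B /Ft FB.
by have [u [uL uB]] := filter_ex (filterI FL FB); exists u.
Qed.

Lemma packing_finite (T : clcr_tree R) (s r : R) : 0 < r ->
  exists N, forall n, packing T n s r -> (n <= N)%N.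
Proof.
move=> r0; have [N NP] := totally_bounded_packing
  (@tree_ball_totally_bounded R T s) r0.
exists N => n [y [ys yr]]; apply: (NP n y) => [i|i j /yr]; exact: ltW.
Qed.

(** Packing numbers of one tree are finite. With the margin r / 2 such a bound persists in a
    neighbourhood, and compactness makes it uniform. *)
Lemma compact_packing_bounded (K : set (trees R)) (s r : R) : compact K ->
  0 < r -> exists N, forall t, K t -> ~ packing (tree_repr t) N.+1 s r.
Proof.
move=> /compact_near_coveringP cK r0.
have : \forall N \near \oo, K `<=` (fun t => ~ packing (tree_repr t) N.+1 s r).
  apply: (cK _ _ (fun N t => ~ packing (tree_repr t) N.+1 s r)) => t Kt.
  have r20 : 0 < r / 2 by rewrite divr_gt0.
  have [N NP] := packing_finite (tree_repr t) (s + r / 2) r20.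
  exists ([set t' | exists2 e : R, 0 < e &
      ~ packing (tree_repr t') N.+1 (s + e) (r - e)], [set n | (N <= n)%N]).
    split; last by exists N.
    apply: open_nbhs_nbhs; split; first exact: open_packing_lt.
    exists (r / 2) => //; have -> : r - r / 2 = r / 2 by lra.
    by move/NP; rewrite ltnn.
  move=> [t' n] /= [[e e0 nt'] Nn] tn; apply: nt'.
  by apply: packing_le (packing_monotone _ _ tn); rewrite ?ltnS//; lra.
by move=> [N _ NK]; exists N => t; apply: (NK N) => /=.
Qed.

(** Witnesses cut at height a + h are 2 h apart; the extra 1 makes their heights strictly below the
    bound. *)
Lemma level_count_lt_packing (h a : R) N t : 0 < h -> 0 < a ->
  ~ packing (tree_repr t) N.+1 (a + h + 1) h -> (level_count h a t <= N)%N.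
Proof.
move=> h0 a0 npk; rewrite leqNgt; apply/negP => /(level_countP _ _ h0 a0).
have ah : 0 <= a + h by rewrite addr_ge0// ltW.
move=> /(spread_truncated ah)[y [ya yb]]; apply: npk; exists y.
split => [i|i j /yb]; first by rewrite ya ltrDl.
by rewrite /gprod -!/(height _) !ya; lra.
Qed.

(* Points are sorted by height into slices of width h; each slice gives a spread
   family whose branch points lie below the previous slice. *)
Lemma packing_spread (T : clcr_tree R) n M (h : R) (N : nat -> nat) : 0 < h ->
  (1 + \sum_(1 <= i < M.+1) N i < n)%N -> packing T n (M%:R * h) (4 * h) ->
  exists2 i, (0 < i)%N & spread T (N i).+1 (i%:R * h) (i%:R * h + h).
Proof.
move=> h0 Nn [y [ys yr]].
pose c k := Num.truncn (height (y k) / h).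
have cP k : (c k)%:R * h <= height (y k) /\ height (y k) < (c k).+1%:R * h.
  have : 0 <= height (y k) / h by rewrite divr_ge0 ?mdist_ge0// ltW.
  move=> /truncn_itv; rewrite -/(c k) => /andP[].
  by rewrite ler_pdivlMr// ltr_pdivrMr.
have cM k : ((c k).-1 < M.+1)%N.
  have : (c k)%:R * h < M%:R * h by exact: le_lt_trans (cP k).1 (ys k).
  rewrite ltr_pM2r// ltr_nat => ckM.
  by rewrite (leq_ltn_trans (leq_pred _))// ltnW// ltnS.
(* The predecessor merges slices 0 and 1 into class 0; a class i > 0 is the slice i + 1. *)
pose cls k : 'I_M.+1 := Ordinal (cM k).
(* Two points of height below 2 h are less than 4 h apart. This class accounts for the term 1 in the
   bound. *)
have cls0 : (#|[pred k | cls k == ord0]| <= 1)%N.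
  apply/card_le1P => k; rewrite inE => /eqP k0 k'; rewrite !inE.
  apply/idP/idP => [/eqP k'0|/eqP ->]; last by rewrite k0.
  apply: contrapT => /negP/yr.
  have low l : cls l = ord0 -> height (y l) < 2 * h.
    move/(congr1 val) => /= cl; apply: lt_le_trans (cP l).2 _.
    by rewrite ler_pM2r// ler_nat ltnS; case: (c l) cl => [|[]].
  have := low _ k0; have := low _ k'0.
  have := metric_triangle (y k') (tree_root T) (y k).
  by rewrite (metric_sym (y k') (tree_root T)) -!/(height _); lra.
have [i iN] : exists i : 'I_M, (N i.+1 < #|[pred k | cls k == lift ord0 i]|)%N.
  apply: contrapT => nex; move: Nn; rewrite ltnNge => /negP; apply.
  rewrite -[n in (n <= _)%N]card_ord -sum1_card.
  rewrite (partition_big cls xpredT)//= big_ord_recl; apply: leq_add.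
    by rewrite sum1_card.
  rewrite big_add1 big_mkord; apply: leq_sum => i _; rewrite sum1_card leqNgt.
  by apply/negP => iN; apply: nex; exists i.
exists i.+1 => //.
exists (fun l => y (enum_val (widen_ord iN l))).
(* Heights now lie in [(i + 2) h, (i + 3) h). Since distances exceed 4 h, Gromov products are below
   2 (i + 1) h: this is where the factor 4 comes from. *)
have cE l : c (enum_val (widen_ord iN l)) = i.+2.
  have := enum_valP (widen_ord iN l); rewrite inE => /eqP/(congr1 val)/=.
  by rewrite /bump/=; case: (c _) => // c' /= ->; rewrite add1n.
split => [l|l l' ll'].
  by have [+ _] := cP (enum_val (widen_ord iN l)); rewrite cE -(natr1 i.+1);
    lra.
have /yr : enum_val (widen_ord iN l) != enum_val (widen_ord iN l').
  by rewrite (inj_eq enum_val_inj).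
have [_ +] := cP (enum_val (widen_ord iN l)).
have [_ +] := cP (enum_val (widen_ord iN l')).
by rewrite !cE /gprod -!/(height _) -(natr1 i.+2) -(natr1 i.+1); lra.
Qed.

End compact_sets_of_trees.

(** * Tightness *)

Section tightness.
Context {R : realType} (J : Type) (d : J -> measure_display)
  (Om : forall j, measurableType (d j)) (P : forall j, probability (Om j) R)
  (X : forall j, {RV (P j) >-> trees R}).

Let X_measurable j (A : set (trees R)) : measurable A ->
  measurable (X j @^-1` A).
Proof. by move=> mA; rewrite -[_ @^-1` _]setTI; exact: measurable_funP. Qed.

(** Tightness on nat in terms of tails, a form that is compared directly when one count dominates
    another. *)
Definition tail_tight (f : trees R -> nat) := forall e : R, 0 < e ->
  exists N, forall j, (P j (X j @^-1` [set t | (N < f t)%N]) <= e%:E)%E.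

Lemma compact_nat_bounded (K : set nat) : compact K ->
  exists N, forall n, K n -> (n <= N)%N.
Proof.
move=> /compact_near_coveringP cK.
have : \forall N \near \oo, K `<=` (fun n => (n <= N)%N).
  apply: (cK _ _ (fun N n => (n <= N)%N)) => n _.
  exists ([set n], [set N | (n <= N)%N]); last by move=> [n' N] /= [->].
  by split; [exact: discrete_set1|exists n].
by move=> [N _ NK]; exists N => n; exact: (NK N (leqnn N)).
Qed.

Lemma tight_tail_tight (f : trees R -> nat) :
  (forall n, measurable [set t | (n <= f t)%N]) ->
  tight (fun j => pushforward (P j) (f \o X j)) <-> tail_tight f.
Proof.
move=> mf; split=> ft e /ft.
  move=> [K [cK _ Ke]]; have [N KN] := compact_nat_bounded cK.
  exists N => j; apply: le_trans (Ke j); rewrite /pushforward.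
  have mK : measurable (X j @^-1` (f @^-1` (~` K))).
    by apply: X_measurable; exact: measurable_nat_preimage.
  apply: le_measure; rewrite ?inE//; first by apply: X_measurable; exact: mf.
  by move=> w /= Nf /KN; rewrite leqNgt Nf.
move=> [N Ne]; exists `I_N.+1; split.
- exact/finite_compact/finite_II.
- by apply: sub_sigma_algebra; exact: discrete_open.
- move=> j; apply: le_trans (Ne j); rewrite /pushforward.
  rewrite (_ : (f \o X j) @^-1` (~` `I_N.+1) = X j @^-1` [set t | (N < f
    t)%N])//.
  by apply/seteqP; split => w /=; rewrite ltnS ltnNge => /negP.
Qed.

Lemma tail_tight_le (f g : trees R -> nat) :
  (forall n, measurable [set t | (n <= f t)%N]) ->
  (forall n, measurable [set t | (n <= g t)%N]) ->
  (forall t, (f t <= g t)%N) -> tail_tight g -> tail_tight f.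
Proof.
move=> mf mg fg gt e /gt[N Ne]; exists N => j; apply: le_trans (Ne j).
apply: le_measure; rewrite ?inE; [by apply: X_measurable;
  exact: mf|by apply: X_measurable; exact: mg|].
by move=> w /= Nf; exact: leq_trans (fg _).
Qed.

Lemma tight_level_count (h a : R) : 0 < h -> 0 < a ->
  tight (fun j => distribution (P j) (X j)) -> tail_tight (level_count h a).
Proof.
move=> h0 a0 Xt e /Xt[K [cK mK Ke]].
have [N NK] := compact_packing_bounded (a + h + 1) cK h0.
exists N => j; apply: le_trans (Ke j).
apply: le_measure; rewrite ?inE.
- by apply: X_measurable; exact: measurable_level_count_ge.
- by apply/X_measurable/measurableC.
by move=> w /= Nw /NK /(level_count_lt_packing h0 a0); rewrite leqNgt Nw.
Qed.

Lemma level_count_tight :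
  (forall h a : R, 0 < h -> 0 < a -> tail_tight (level_count h a)) ->
  tight (fun j => distribution (P j) (X j)).
Proof.
move=> ft e e0.
pose h m : R := mesh R m / 4.
have h0 m : 0 < h m by rewrite divr_gt0// mesh_gt0.
have a0 m i : (0 < i)%N -> 0 < i%:R * h m by move=> i0;
  rewrite mulr_gt0// ltr0n.
have ep (p : nat) : 0 < e / (2 ^ p.+1)%:R by rewrite divr_gt0// ltr0n expn_gt0.
(* Each pair (mesh index, level index) receives its own share of [e] through its code; level index 0
   is set aside because the hypothesis concerns positive levels. *)
have /choice[N NP] (q : nat * nat) : exists N, (0 < q.2)%N -> forall j,
    (P j (X j @^-1` [set t | (N < level_count (h q.1) (q.2%:R * h q.1) t)%N])
      <= (e / (2 ^ (choice.pickle q).+1)%:R)%:E)%E.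
  have [q0|] := posnP q.2; first by exists 0%N; rewrite q0.
  by move=> /(a0 q.1)/(ft _ _ (h0 q.1))/(_ _ (ep (choice.pickle q)))[N Ne];
    exists N.
(* Chosen so that [M s m] slices of width [h m] fill the heights below [s] exactly. *)
pose M s m := (4 * m.+1 * s)%N.
pose L s m := (1 + \sum_(1 <= i < (M s m).+1) N (m, i))%N.
exists (packing_bounded L); split; first exact: packing_bounded_compact.
  rewrite -[packing_bounded L]setCK; apply: sigma_algebraC.
  by apply: sub_sigma_algebra; exact/closed_openC/packing_bounded_closed.
(* Numbers that code no pair, or a pair with level index 0, get the empty event, so that the events
   are indexed by all of nat. *)
pose B p : set (trees R) := if pickle_inv p is Some q then
    if (0 < q.2)%N then
      [set t | (N q < level_count (h q.1) (q.2%:R * h q.1) t)%N]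
    else set0
  else set0.
have mB p : measurable (B p).
  rewrite /B; case: pickle_inv => [q|]; last exact: measurable0.
  case: ifP => [q0|_]; last exact: measurable0.
  by apply: measurable_level_count_ge => //; exact: a0.
have BL : ~` packing_bounded L `<=` \bigcup_p B p.
  move=> t nt.
  have [s [m tsm]] : exists s m, packing (tree_repr t) (L s m).+1 s%:R (mesh R
    m).
    apply: contrapT => nex; apply: nt => s m tsm; apply: nex.
    by exists s, m.
  have Mh : s%:R = (M s m)%:R * h m :> R.
    rewrite /M /h /mesh !natrM.
    have m1 : m.+1%:R != 0 :> R by rewrite pnatr_eq0.
    by rewrite mulrAC mulrA mulfK// divff// mul1r.
  have h4 : mesh R m = 4 * h m by rewrite /h mulrC divfK.
  rewrite Mh h4 in tsm.
  have [i i0 ti] := packing_spread (h0 m) (ltnSn (L s m)) tsm.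
  exists (choice.pickle (m, i)) => //; rewrite /B pickleK_inv/= i0.
  by apply/level_countP => //; exact: a0.
move=> j; apply: (@le_trans _ _ (\sum_(p <oo) P j (X j @^-1` B p))%E).
  apply: (@measure_sigma_subadditive _ _ _ (P j)
    (X j @^-1` (~` packing_bounded L)) (fun p => X j @^-1` B p)).
  - by move=> p; apply: X_measurable; exact: mB.
  - apply: X_measurable; apply: open_measurable_trees.
    exact/closed_openC/packing_bounded_closed.
  - by move=> w /BL[p _ Bp]; exists p.
apply: le_trans (epsilon_trick0 xpredT (ltW e0)); apply: lee_nneseries.
  by move=> *; exact: measure_ge0.
move=> p _ /=; have := pickle_invK (T := (nat * nat)%type) p; rewrite /B.
case: pickle_inv => [q /= <-|_];
  last by rewrite preimage_set0 measure0 lee_fin ltW.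
case: ifP => [q0|_]; first exact: NP.
by rewrite preimage_set0 measure0 lee_fin ltW.
Qed.

End tightness.

Theorem theorem2p9 (R : realType) (J : Type) (d : J -> measure_display)
    (Om : forall j, measurableType (d j)) (P : forall j, probability (Om j) R)
    (X : forall j, {RV (P j) >-> trees R}) :
  (tight (fun j => distribution (P j) (X j)) <->
   forall h a : R, 0 < h -> 0 < a ->
     tight (fun j => pushforward (P j) (level_count h a \o X j))) /\
  (tight (fun j => distribution (P j) (X j)) <->
   forall h a : R, 0 < h -> 0 < a ->
     tight (fun j => pushforward (P j) (level_count_right h a \o X j))).
Proof.
have mc h a : 0 < h -> 0 < a ->
    forall n, measurable [set t : trees R | (n <= level_count h a t)%N].
  by move=> h0 a0 n; exact: measurable_level_count_ge.
have mr h a : 0 < h -> 0 < a ->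
    forall n, measurable [set t : trees R | (n <= level_count_right h a t)%N].
  by move=> h0 a0 n; exact: measurable_level_count_right_ge.
split; split=> [Xt h a h0 a0|Zt].
- by apply/tight_tail_tight; [exact: mc|exact: tight_level_count].
- apply: level_count_tight => h a h0 a0.
  by apply/tight_tail_tight; [exact: mc|exact: Zt].
- apply/tight_tail_tight; first exact: mr.
  have h20 : 0 < h / 2 by rewrite divr_gt0.
  have ah : 0 < a + h / 2 by rewrite addr_gt0.
  apply: tail_tight_le (tight_level_count h20 ah Xt); [exact: mr|exact: mc|].
  by move=> t; exact: level_count_right_le.
- apply: level_count_tight => h a h0 a0.
  have h20 : 0 < h / 2 by rewrite divr_gt0.
  have Zr : tail_tight X (level_count_right (h / 2) a).
    by apply/tight_tail_tight; [exact: mr|exact: Zt].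
  apply: tail_tight_le Zr; [exact: mc|exact: mr|].
  by move=> t; exact: level_count_le_right.
Qed.
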